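(* Fix an integer $r \geq 3$. Let $\mathcal{P}^r = \{ (d_3(G), d_4(G)) : G \text{ is an } r\text{-regular finite simple graph} \} \subset \mathbb{R}^2$, and let $\mathcal{Q}^r$ be the convex hull of the points $P^r_0, P^r_1, \ldots, P^r_r$ defined below. Then $\mathcal{P}^r = \{ (x,y) \in \mathcal{Q}^r : x, y \in \mathbb{Q} \}$. In particular, the closure of $\mathcal{P}^r$ equals $\mathcal{Q}^r$.
   Context: For a finite simple graph $G$ with vertex set $V(G)$, $c_k(G)$ denotes the total number of $k$-cycles (cycles of length $k$, counted as subgraphs) in $G$, and $d_k(G) = c_k(G)/|V(G)|$. Graphs need not be connected. Define $P^r_0 = \left(0, \frac{r(r-1)^2}{8}\right)$ (this is $(d_3,d_4)$ of the complete bipartite graph $K_{r,r}$). For $1 \leq l \leq r$, set $r_i = \lfloor (r+i-1)/l \rfloor$ for $i = 1, \ldots, l$ (the partition of $r$ into $l$ parts as equal as possible) and define $$P^r_l = \left( \frac{1}{3}\sum_{i=1}^{l} \binom{r_i}{2},\ \frac{1}{4} \sum_{i=1}^{l} r_i \binom{r_i - 1}{2} \right).$$ *)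

(* Defs.v *)
From HB Require Import structures.
From mathcomp Require Import all_boot all_order all_algebra.
From mathcomp Require Import all_classical all_reals all_analysis.

Set Implicit Arguments.
Unset Strict Implicit.
Unset Printing Implicit Defensive.

Import Order.TTheory GRing.Theory Num.Theory.
Import numFieldNormedType.Exports.

Local Open Scope ring_scope.

Record simple_graph := SimpleGraph {
  vertex :> finType;
  adj : rel vertex;
  adj_sym : symmetric adj;
  adj_irr : irreflexive adj
}.

Definition degree (G : simple_graph) (x : G) : nat := #|[pred y | adj x y]|.

Definition regular (r : nat) (G : simple_graph) : Prop :=
  forall x : G, degree x = r.

(* A k-cycle, as a subgraph (k >= 3), is identified with its set of edges, so
   that the 2k cyclic sequences traversing it are counted only once. *)
Definition cycle_edges (T : finType) (s : seq T) : {set {set T}} :=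
  [set [set x; next s x]%SET | x in s]%SET.

Definition cycles (k : nat) (G : simple_graph) : {set {set {set G}}} :=
  [set F : {set {set G}} |
    [exists t : k.-tuple G, ucycleb (@adj G) t && (F == cycle_edges t)]]%SET.

Definition cycle_count (k : nat) (G : simple_graph) : nat := #|cycles k G|.

Definition cycle_density (R : realType) (k : nat) (G : simple_graph) : R :=
  (cycle_count k G)%:R / #|G|%:R.

(* The i-th part, 1 <= i <= l, of the partition of r into l <= r parts that are
   as equal as possible; these parts are all positive. *)
Definition part (r l i : nat) : nat := ((r + i - 1) %/ l)%N.

(* The plane is R^o * R^o, i.e. R * R with its structure of normed module over
   R. *)
Definition hull_point (R : realType) (r l : nat) : R^o * R^o :=
  if l == 0%N then (0, (r * (r - 1) ^ 2)%:R / 8%:R)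
  else (3%:R^-1 * (\sum_(1 <= i < l.+1) 'C(part r l i, 2))%:R,
        4%:R^-1 * (\sum_(1 <= i < l.+1) part r l i * 'C(part r l i - 1, 2))%:R).

Arguments hull_point : clear implicits.

Local Open Scope classical_set_scope.

Definition convex_hull (R : realType) (M : lmodType R) (A : set M) : set M :=
  smallest (@convex_set R M) A.

(* Graphs are required to have a vertex, since the densities divide by the
   number of vertices. *)
Definition density_set (R : realType) (r : nat) : set (R^o * R^o) :=
  [set p | exists G : simple_graph, [/\ (0 < #|G|)%N, regular r G &
    p = (cycle_density R 3 G, cycle_density R 4 G)]].

Definition density_polygon (R : realType) (r : nat) : set (R^o * R^o) :=
  convex_hull [set hull_point R r l | l in [set l | (l <= r)%N]].

Arguments density_set : clear implicits.
Arguments density_polygon : clear implicits.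

(* Main.v *)
Require Import Defs.
From mathcomp Require Import all_boot all_order all_algebra.
From mathcomp Require Import all_classical all_reals all_analysis.
From mathcomp Require Import zify ring lra.
Import numFieldNormedType.Exports.
Local Open Scope classical_set_scope.
Local Open Scope ring_scope.

Set Implicit Arguments.
Unset Strict Implicit.
Unset Printing Implicit Defensive.
Import Order.TTheory GRing.Theory Num.Theory.

(** A nonbacktracking walk of length 3 either closes up into a triangle or is
    three quarters of at most one square, which gives the edge P_0 P_1. For the
    lower edges, minimize d_4 - lambda d_3. A square is seen from its vertices
    through its diagonals, so that up to a constant this quantity is bounded
    below by the average over the vertices of an "energy" of the neighbourhood
    graph. Cloning either of two adjacent vertices into the other shows (as in
    Zykov's symmetrization) that a graph of minimal energy is a disjoint union
    of cliques; its energy is then a sum of cubic polynomials in their sizes,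
    and merging or balancing two cliques reduces to r split into l parts as
    equal as possible, which is P_l.

    Conversely, a product of G and H whose coordinates are twisted by a third
    one in F_p, so that G-edges and H-edges do not commute, adds degrees and
    densities; products of complete graphs thus realize P_l for l >= 1, and
    K_{r,r} realizes P_0. Disjoint unions give rational convex combinations. *)

(** * Counting cycles *)

(** For a graph, each triangle is counted 6 times, once for every starting vertex and direction. *)
Definition triangles (T : finType) (e : rel T) : nat :=
  (\sum_x \sum_y \sum_z [&& e x y, e y z & e z x])%N.

(** For a graph, each square is counted 8 times. Only opposite vertices need an explicit inequality:
    consecutive ones differ by irreflexivity. *)
Definition squares (T : finType) (e : rel T) : nat :=
  (\sum_x \sum_y \sum_z \sum_w
     [&& e x y, e y z, e z w & e w x] && ((x != z) && (y != w)))%N.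

Lemma sum_tupleS (T : finType) n (F : n.+1.-tuple T -> nat) :
  \sum_(t : n.+1.-tuple T) F t = \sum_x \sum_(t : n.-tuple T) F [tuple of x :: t].
Proof.
rewrite pair_big /= (reindex (fun p : T * n.-tuple T => [tuple of p.1 :: p.2])) //=.
exists (fun t => (thead t, [tuple of behead t])) => [[x t]|t] _ /=.
  by congr pair; apply: val_inj.
by rewrite -tuple_eta.
Qed.

Lemma sum_tuple0 (T : finType) (F : 0.-tuple T -> nat) :
  \sum_(t : 0.-tuple T) F t = F [tuple].
Proof.
rewrite (big_pred1 [tuple]) // => t /=; by rewrite [t]tuple0; apply/esym/eqP.
Qed.

Section CycleCount.
Variable G : simple_graph.
Implicit Types x y z w a b c d : G.
Local Open Scope nat_scope.

Lemma set2_eq x y a b :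
  ([set a; b]%SET == [set x; y]%SET) =
    ((a == x) && (b == y)) || ((a == y) && (b == x)).
Proof.
apply/eqP/idP => [E|/orP[]/andP[/eqP-> /eqP->] //]; last exact: finset.setUC.
have := finset.set21 a b; rewrite E !inE => /orP[]/eqP aE.
  have := finset.set22 a b; rewrite E !inE => /orP[]/eqP bE; subst a b;
    rewrite !eqxx ?orbT //.
  have := finset.set22 x y; rewrite -E !inE => /orP[]/eqP ->; by rewrite !eqxx.
have := finset.set22 a b; rewrite E !inE => /orP[]/eqP bE; subst a b;
  rewrite !eqxx ?orbT //.
have := finset.set21 x y; rewrite -E !inE => /orP[]/eqP ->; by rewrite !eqxx.
Qed.

Lemma cycle_edges3 x y z : uniq [:: x; y; z] ->
  cycle_edges [:: x; y; z] =
    [set [set x; y]%SET; [set y; z]%SET; [set z; x]%SET]%SET.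
Proof.
rewrite /= !inE !negb_or andbT => /andP[/andP[xy xz] yz].
apply/setP => F; rewrite !inE; apply/imsetP/idP.
  move=> [u]; rewrite !inE => /or3P[]/eqP -> ->; rewrite /= ?eqxx;
  rewrite ?[y == x]eq_sym ?[z == x]eq_sym ?[z == y]eq_sym;
  by rewrite ?(negPf xy) ?(negPf xz) ?(negPf yz) ?eqxx ?orbT.
move=> /orP[/orP[]|] /eqP ->; [exists x|exists y|exists z]; rewrite ?inE ?eqxx ?orbT //=.
all: rewrite ?[y == x]eq_sym ?[z == x]eq_sym ?[z == y]eq_sym;
  by rewrite ?(negPf xy) ?(negPf xz) ?(negPf yz) ?eqxx.
Qed.

Lemma cycle_edges4 x y z w : uniq [:: x; y; z; w] ->
  cycle_edges [:: x; y; z; w] =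
    [set [set x; y]%SET; [set y; z]%SET; [set z; w]%SET; [set w; x]%SET]%SET.
Proof.
rewrite /= !inE !negb_or andbT => /and3P[/and3P[xy xz xw] /andP[yz yw] zw].
apply/setP => F; rewrite !inE; apply/imsetP/idP.
  move=> [u]; rewrite !inE => /or4P[]/eqP -> ->; rewrite /= ?eqxx;
  rewrite ?[y == x]eq_sym ?[z == x]eq_sym ?[z == y]eq_sym
     ?[w == x]eq_sym ?[w == y]eq_sym ?[w == z]eq_sym;
  by rewrite ?(negPf xy) ?(negPf xz) ?(negPf yz) ?(negPf xw) ?(negPf yw) ?(negPf zw)
    ?eqxx ?orbT.
move=> /orP[/orP[/orP[]|]|] /eqP ->; [exists x|exists y|exists z|exists w];
  rewrite ?inE ?eqxx ?orbT //=.
all: rewrite ?[y == x]eq_sym ?[z == x]eq_sym ?[z == y]eq_sym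
     ?[w == x]eq_sym ?[w == y]eq_sym ?[w == z]eq_sym;
  by rewrite ?(negPf xy) ?(negPf xz) ?(negPf yz) ?(negPf xw) ?(negPf yw) ?(negPf zw)
    ?eqxx.
Qed.

(** Double counting: the tuples traversing a cycle are grouped by their edge sets, and all groups
    have size [m]. *)
Lemma cycle_count_fiber k m :
  (forall t : k.-tuple G, ucycleb (@adj G) t ->
     #|[set u : k.-tuple G | ucycleb (@adj G) u
          && (cycle_edges u == cycle_edges t)]%SET| = m) ->
  cycle_count k G * m = #|[set t : k.-tuple G | ucycleb (@adj G) t]%SET|.
Proof.
move=> fib.
have -> : cycle_count k G =
    #|(fun t : k.-tuple G => cycle_edges t) @:
       [set t : k.-tuple G | ucycleb (@adj G) t]%SET|.
  apply: eq_card => F; rewrite inE; apply/existsP/imsetP.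
    by move=> [t /andP[ct /eqP ->]]; exists t; rewrite ?inE.
  by move=> [t]; rewrite inE => ct ->; exists t; rewrite ct eqxx.
rewrite -sum_nat_const -[RHS]sum1_card.
rewrite (partition_big_imset (fun t : k.-tuple G => cycle_edges t)) /=.
apply: eq_bigr => F /imsetP[t]; rewrite inE => ct ->.
rewrite sum1dep_card -(fib t ct).
by apply: eq_card => u; rewrite !inE.
Qed.

Lemma tuple3E (t : 3.-tuple G) : exists x y z, t = [tuple x; y; z].
Proof.
case/tupleP: t => x t; case/tupleP: t => y t; case/tupleP: t => z t.
by exists x, y, z; apply: val_inj; rewrite /= tuple0.
Qed.

Lemma tuple4E (t : 4.-tuple G) : exists x y z w, t = [tuple x; y; z; w].
Proof.
case/tupleP: t => x t; case: (tuple3E t) => y [z [w ->]].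
by exists x, y, z, w; apply: val_inj.
Qed.

Lemma triangles_card :
  #|[set t : 3.-tuple G | ucycleb (@adj G) t]%SET| = triangles (@adj G).
Proof.
rewrite cardsE -sum1_card big_mkcond /= !sum_tupleS /triangles.
apply: eq_bigr => x _; rewrite sum_tupleS; apply: eq_bigr => y _; rewrite sum_tupleS.
apply: eq_bigr => z _; rewrite sum_tuple0 unfold_in /ucycleb /= !inE !andbT.
have [xy|] := boolP (adj x y) => //; have [yz|] := boolP (adj y z) => //=.
have [zx|] := boolP (adj z x) => //=.
case: eqP xy => [->|_ _]; first by rewrite adj_irr.
case: eqP zx => [->|_ _]; first by rewrite adj_irr.
by case: eqP yz => [->|]; first by rewrite adj_irr.
Qed.

Lemma squares_card :
  #|[set t : 4.-tuple G | ucycleb (@adj G) t]%SET| = squares (@adj G).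
Proof.
rewrite cardsE -sum1_card big_mkcond /= !sum_tupleS /squares.
apply: eq_bigr => x _; rewrite sum_tupleS; apply: eq_bigr => y _; rewrite sum_tupleS.
apply: eq_bigr => z _; rewrite sum_tupleS; apply: eq_bigr => w _.
rewrite sum_tuple0 unfold_in /ucycleb /= !inE !negb_or !andbT.
have [xy|] := boolP (adj x y) => //; have [yz|] := boolP (adj y z) => //=.
have [zw|] := boolP (adj z w) => //=; have [wx|] := boolP (adj w x) => //=.
case: (x =P y) xy => [->|_ _]; first by rewrite adj_irr.
case: (y =P z) yz => [->|_ _]; first by rewrite adj_irr.
case: (z =P w) zw => [->|_ _]; first by rewrite adj_irr.
case: (x =P w) wx => [->|_ _]; first by rewrite adj_irr.
by rewrite /= !andbT; case: ifP.
Qed.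
Lemma cycle_count3 : cycle_count 3 G * 6 = triangles (@adj G).
Proof.
rewrite -triangles_card; apply: cycle_count_fiber => t.
case: (tuple3E t) => x [y [z ->]] /andP[cyc U].
have ex := cycle_edges3 U.
move: (U) cyc; rewrite /= !inE !negb_or !andbT.
move=> /andP[/andP[xy xz] yz] /and3P[exy eyz ezx].
have ne := (negPf xy, negPf xz, negPf yz).
have yx := xy; have zx := xz; have zy := yz.
rewrite eq_sym in yx; rewrite eq_sym in zx; rewrite eq_sym in zy.
have en := (negPf yx, negPf zx, negPf zy).
(* The rotations and reflections of the triangle. *)
pose s := [:: [tuple x; y; z]; [tuple y; z; x]; [tuple z; x; y];
              [tuple z; y; x]; [tuple y; x; z]; [tuple x; z; y]].
have <- : #|s| = 6.
  apply/card_uniqP.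
  by rewrite /= !inE -!val_eqE /= !eqseq_cons !andbT !ne !en /= ?andbF.
apply: eq_card => u; rewrite inE.
case: (tuple3E u) => a [b [c ->]].
rewrite !inE -!val_eqE /= !eqseq_cons !andbT.
apply/idP/idP.
  (* Locating the edges [a b] and [b c] among the three edges of the triangle determines the
     tuple. *)
  move=> /andP[/andP[_ Ua]]; rewrite (cycle_edges3 Ua) ex =>
    /(elimT (@eqP {set {set G}} _ _)) E.
  have E1 := congr1 (fun A : {set {set G}} => [set a; b]%SET \in A) E.
  have E2 := congr1 (fun A : {set {set G}} => [set b; c]%SET \in A) E.
  move: E1 E2 Ua; rewrite /= !inE !eqxx ?orbT => /esym E1 /esym E2.
  rewrite !negb_or !andbT => /andP[/andP[ab ac] bc].
  move: E1; rewrite !set2_eq => /orP[/orP[]|] /orP[]/andP[/eqP ? /eqP ?]; subst a b;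
  move: E2 ac bc; rewrite !set2_eq ?eqxx ?ne ?en ?orbF ?andbT ?orbT /=;
  by move=> /orP[]/eqP ->; rewrite ?eqxx ?ne ?en ?orbT.
have sy := (@adj_sym G).
move=> /orP[|/orP[|/orP[|/orP[|/orP[]]]]] /and3P[/eqP-> /eqP-> /eqP->];
  rewrite /ucycleb /= !inE ?ne ?en /= ?[adj y x]sy ?[adj x z]sy ?[adj z y]sy
    ?exy ?eyz ?ezx /=.
all: rewrite !cycle_edges3 /= ?inE ?ne ?en //.
all: apply: (introT (@eqP {set {set G}} _ _)); apply/setP => F; rewrite !inE.
all: rewrite ?[[set y; x]%SET]finset.setUC ?[[set z; y]%SET]finset.setUC ?[[set x;
  z]%SET]finset.setUC.
all: by move: (F == [set x; y]%SET) (F == [set y; z]%SET) (F == [set z; x]%SET) =>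
  [] [] [].
Qed.

Lemma cycle_count4 : cycle_count 4 G * 8 = squares (@adj G).
Proof.
rewrite -squares_card; apply: cycle_count_fiber => t.
case: (tuple4E t) => x [y [z [w ->]]] /andP[cyc U].
have ex := cycle_edges4 U.
move: (U) cyc; rewrite /= !inE !negb_or !andbT.
move=> /and3P[/and3P[xy xz xw] /andP[yz yw] zw] /and4P[exy eyz ezw ewx].
have ne := (negPf xy, negPf xz, negPf yz, negPf xw, negPf yw, negPf zw).
have yx := xy; have zx := xz; have zy := yz; have wx := xw; have wy := yw; have wz := zw.
rewrite eq_sym in yx; rewrite eq_sym in zx; rewrite eq_sym in zy.
rewrite eq_sym in wx; rewrite eq_sym in wy; rewrite eq_sym in wz.
have en := (negPf yx, negPf zx, negPf zy, negPf wx, negPf wy, negPf wz).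
(* The eight symmetries of the square. *)
pose s := [:: [tuple x; y; z; w]; [tuple y; z; w; x]; [tuple z; w; x; y];
              [tuple w; x; y; z]; [tuple w; z; y; x]; [tuple z; y; x; w];
              [tuple y; x; w; z]; [tuple x; w; z; y]].
have <- : #|s| = 8.
  apply/card_uniqP.
  by rewrite /= !inE -!val_eqE /= !eqseq_cons !andbT !ne !en /= ?andbF.
apply: eq_card => u; rewrite inE.
case: (tuple4E u) => a [b [c [d ->]]].
rewrite !inE -!val_eqE /= !eqseq_cons !andbT.
apply/idP/idP.
(* Here three consecutive edges have to be located. *)
{ move=> /andP[/andP[_ Ua]]; rewrite (cycle_edges4 Ua) ex =>
  /(elimT (@eqP {set {set G}} _ _)) E.
  have E1 := congr1 (fun A : {set {set G}} => [set a; b]%SET \in A) E.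
  have E2 := congr1 (fun A : {set {set G}} => [set b; c]%SET \in A) E.
  have E3 := congr1 (fun A : {set {set G}} => [set c; d]%SET \in A) E.
  move: E1 E2 E3 Ua; rewrite /= !inE !eqxx ?orbT => /esym E1 /esym E2 /esym E3.
  rewrite !negb_or !andbT => /and3P[/and3P[ab ac ad] /andP[bc bd] cd].
  move: E1; rewrite !set2_eq => /orP[/orP[/orP[]|]|] /orP[]/andP[/eqP ? /eqP ?];
    subst a b;
  move: E2; rewrite !set2_eq ?eqxx ?ne ?en ?orbF ?andbT ?orbT /=.
  all: move=> /orP[]/eqP ?; subst c.
  all: move: ac E3 ad bd; rewrite ?eqxx //= => _;
    rewrite !set2_eq ?eqxx ?ne ?en ?orbF ?andbT ?orbT /=.
  all: by move=> /orP[]/eqP ->; rewrite ?eqxx ?ne ?en ?orbT. }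
have sy := (@adj_sym G).
move=> /orP[|/orP[|/orP[|/orP[|/orP[|/orP[|/orP[]]]]]]] /and4P[/eqP-> /eqP-> /eqP->
  /eqP->];
  rewrite /ucycleb /= !inE ?ne ?en /= ?[adj y x]sy ?[adj x w]sy ?[adj w z]sy ?[adj z y]sy
    ?exy ?eyz ?ezw ?ewx /=.
all: rewrite !cycle_edges4 /= ?inE ?ne ?en //.
all: apply: (introT (@eqP {set {set G}} _ _)); apply/setP => F; rewrite !inE.
all: rewrite ?[[set y; x]%SET]finset.setUC ?[[set z; y]%SET]finset.setUC
       ?[[set x; w]%SET]finset.setUC ?[[set w; z]%SET]finset.setUC.
all: by move: (F == [set x; y]%SET) (F == [set y; z]%SET) (F == [set z; w]%SET)
  (F == [set w; x]%SET) => [] [] [] [].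
Qed.

End CycleCount.

(** * Neighbourhood graphs *)

(** Induction on [r]: raising [r] by one shifts the list of parts by one place, and the part that
    leaves at the front comes back at the end, increased by one. *)
Lemma sum_part r l : (0 < l)%N -> (\sum_(1 <= i < l.+1) part r l i)%N = r.
Proof.
case: l => // l _; elim: r => [|r IHr].
  rewrite big_nat big1 // => i /andP[i1 il]; rewrite /part divn_small //; lia.
move: IHr; rewrite big_nat_recl //= => IHr; rewrite big_nat_recr //=.
rewrite [in LHS](eq_big_nat _ _ (F2 := fun i => part r l.+1 i.+1)); last first.
  by move=> i /andP[i1 il]; rewrite /part; congr (_ %/ _)%N; lia.
have -> : part r.+1 l.+1 l.+1 = (part r l.+1 1).+1.
  rewrite /part -[(part r _ _).+1]addn1 (_ : (r.+1 + l.+1 - 1 = r + 1 - 1 + l.+1)%N);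
    last by lia.
  by rewrite divnDr ?dvdnn // divnn /= addn1.
by rewrite addnC addSn IHr.
Qed.

Lemma part_near r l i : (0 < l)%N -> (1 <= i <= l)%N ->
  (part r l i == r %/ l)%N || (part r l i == (r %/ l).+1)%N.
Proof.
move=> l0 /andP[i1 il].
have h1 : (r %/ l <= part r l i)%N by apply: leq_div2r; lia.
have h2 : (part r l i <= (r + l) %/ l)%N by apply: leq_div2r; lia.
have : ((r + l) %/ l = (r %/ l).+1)%N by rewrite divnDr ?dvdnn // divnn l0 addn1.
lia.
Qed.

(** * Sums of cubics over partitions of an integer *)

Section EqualParts.
Variables (R : realFieldType).

(** The value [q.+1] must occur [sumn s - q * size s] times, so that the sum of [g] depends only on
    the size and the sum of the list. *)
Lemma sum_near_const (g : nat -> R) (q : nat) (s : seq nat) :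
  all (fun a : nat => (a == q) || (a == q.+1)) s ->
  (q * size s <= sumn s)%N /\
  \sum_(a <- s) g a =
    g q *+ size s + (g q.+1 - g q) *+ (sumn s - q * size s).
Proof.
elim: s => [|a s IHs] /=; first by rewrite big_nil muln0 addr0.
move=> /andP[aq /IHs[le_s sum_s]]; rewrite big_cons sum_s.
case/orP: aq => /eqP ->.
  split; first by lia.
  by rewrite (_ : q + sumn s - q * (size s).+1 = sumn s - q * size s)%N;
    [rewrite mulrS addrA | lia].
split; first by lia.
rewrite (_ : q.+1 + sumn s - q * (size s).+1 = (sumn s - q * size s).+1)%N; last by lia.
by rewrite !mulrS; ring.
Qed.

(** As [m] itself occurs, it is the quotient of the sum by the size. The list and the equal
    partition then both consist of [m] and [m.+1], with the same size and sum. *)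
Lemma sum_near_eq (g : nat -> R) (m : nat) (s : seq nat) : m \in s ->
  all (fun a : nat => (a == m) || (a == m.+1)) s ->
  \sum_(a <- s) g a =
    \sum_(1 <= i < (size s).+1) g (part (sumn s) (size s) i).
Proof.
move=> ms near_s; have s0 : (0 < size s)%N by case: s ms {near_s}.
have [le_s ->] := sum_near_const g near_s.
have mq : m = (sumn s %/ size s)%N.
  apply/eqP; rewrite eqn_leq leq_divRL // le_s /= -ltnS ltn_divLR //.
  have [s1 [s2 def_s]] : exists s1 s2, s = s1 ++ m :: s2.
    by case/splitPr: ms => s1 s2; exists s1, s2.
  have near1 : forall t, all (fun a : nat => (a == m) || (a == m.+1)) t ->
      (sumn t <= m.+1 * size t)%N.
    elim=> [|a t IHt] //= /andP[am /IHt]; case/orP: am => /eqP ->; rewrite mulnS; lia.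
  move: near_s; rewrite def_s all_cat /= => /and3P[/near1 n1 _ /near1 n2].
  by rewrite sumn_cat size_cat /=; lia.
set p := [seq part (sumn s) (size s) i | i <- index_iota 1 (size s).+1].
have near_p : all (fun a : nat => (a == m) || (a == m.+1)) p.
  apply/allP => a /mapP[i]; rewrite mem_index_iota => i_s ->; rewrite mq.
  by apply: part_near => //; lia.
have size_p : size p = size s by rewrite size_map size_iota subn1.
have sum_p : sumn p = sumn s.
  by rewrite sumnE big_map sum_part.
have [_] := sum_near_const g near_p; rewrite size_p sum_p => <-.
by rewrite /p big_map.
Qed.

Variable k : R.
(** The energy of a clique with [a] vertices, loops included. *)
Definition cubic (a : nat) : R := a%:R ^+ 3 - k * a%:R ^+ 2.

(* Replacing two parts by two others with the same sum changes the value by a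
   multiple of the change of their product, with a factor that depends on the
   sum only: it pays either to merge two unequal parts or to balance them. *)
Lemma sum_cubic_ge_part (s : seq nat) : (0 < sumn s)%N -> all (leq 1) s ->
  exists l, (1 <= l <= sumn s)%N /\
    \sum_(1 <= i < l.+1) cubic (part (sumn s) l i) <= \sum_(a <- s) cubic a.
Proof.
move=> s_gt0; have [n le_n] := ubnP (size s).
(* Merging shortens the list, while balancing keeps its length and decreases the sum of squares;
   hence the nested inductions. *)
elim: n => // n IHn in s s_gt0 le_n *.
have [m le_m] := ubnP (\sum_(a <- s) a ^ 2)%N.
elim: m => // m IHm in s s_gt0 le_n le_m * => s_pos.
have s0 : (0 < size s)%N by case: s s_gt0 {le_n le_m s_pos}.
have [b bs min_b] : exists2 b : nat, b \in s & forall a : nat, a \in s -> (b <= a)%N.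
  have ex : exists b : nat, b \in s by case: s s0 {s_gt0 le_n le_m s_pos} => // a s _;
    exists a; rewrite mem_head.
  by case: (ex_minnP ex) => b ? ?; exists b.
have [near_s|] := boolP (all (fun a : nat => (a == b) || (a == b.+1)) s).
  exists (size s); rewrite s0 /=; split; last by rewrite (sum_near_eq _ bs near_s).
  elim: (s) s_pos => //= a t IHt /andP[a0 /IHt]; lia.
move=> far_s; have [a a_s lt_ab] : exists2 a : nat, a \in s & (b.+1 < a)%N.
  by case/allPn: far_s => a a_s ab; exists a => //; have := min_b _ a_s; lia.
have b_rem : b \in rem a s.
  by move: bs; rewrite (perm_mem (perm_to_rem a_s)) inE => /orP[/eqP E|//]; lia.
set t : seq nat := rem b (rem a s).
have st : perm_eq s [:: a, b & t].
  by apply: perm_trans (perm_to_rem a_s) _; rewrite perm_cons perm_to_rem.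
have size_st : size (s : seq nat) = (size (t : seq nat)).+2 by rewrite (perm_size st).
have sum_st : sumn s = (a + (b + sumn t))%N by rewrite (perm_sumn st).
have := s_pos; rewrite (perm_all _ st) /= => /and3P[a1 b1 t_pos].
have sumE (h : nat -> R) : \sum_(i <- s) h i = h a + (h b + \sum_(i <- t) h i).
  by rewrite (perm_big _ st) /= !big_cons.
have sqE : (\sum_(i <- s) i ^ 2 = a ^ 2 + (b ^ 2 + \sum_(i <- t) i ^ 2))%N.
  by rewrite (perm_big _ st) /= !big_cons.
(* Merging [a] and [b] adds [a * b * (3 * (a + b) - 2 * k)] to the sum; moving one unit from [a] to
   [b] subtracts [(a - 1 - b) * (3 * (a + b) - 2 * k)]. The sign of the common factor decides. *)
have [merge|balance] := lerP (3 * (a + b)%:R : R) (2 * k).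
  have h1 : (0 < sumn ((a + b)%N :: t))%N by rewrite /=; lia.
  have h2 : (size ((a + b)%N :: t) < n)%N by rewrite /=; lia.
  have h3 : all (leq 1) ((a + b)%N :: t) by rewrite /= t_pos; lia.
  have [l [ls le_l]] := IHn _ h1 h2 h3.
  exists l; move: ls le_l; rewrite /= -addnA -sum_st => ls le_l; split=> //.
  apply: le_trans le_l _; rewrite sumE big_cons /cubic /= addrA lerD2r natrD.
  move: merge; rewrite natrD; set x := a%:R; set y := b%:R => merge.
  have x0 : 0 <= x by exact: ler0n.
  have y0 : 0 <= y by exact: ler0n.
  have : 0 <= x * y * (2 * k - 3 * (x + y)) by rewrite mulr_ge0 ?mulr_ge0 // subr_ge0.
  move=> h; rewrite -subr_ge0; apply: le_trans h _; rewrite le_eqVlt.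
  by apply/orP; left; apply/eqP; ring.
have h1 : (0 < sumn (a.-1 :: b.+1 :: t))%N by rewrite /=; lia.
have h2 : (size (a.-1 :: b.+1 :: t) < n.+1)%N by rewrite /=; lia.
have h3 : all (leq 1) (a.-1 :: b.+1 :: t) by rewrite /= t_pos; lia.
have h4 : (\sum_(i <- a.-1 :: b.+1 :: t) i ^ 2 < m)%N.
  have : (a.-1 ^ 2 + b.+1 ^ 2 < a ^ 2 + b ^ 2)%N.
    have [c ->] : exists c, a = (b + c.+2)%N by exists (a - b.+2)%N; lia.
    by rewrite addnS /=; nia.
  by move: le_m; rewrite sqE !big_cons; lia.
have [l [ls le_l]] := IHm _ h1 h2 h4 h3.
exists l; move: ls le_l; rewrite /= (_ : a.-1 + (b.+1 + sumn t) = sumn s)%N; last by lia.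
move=> ls le_l; split => //; apply: le_trans le_l _;
  rewrite sumE !big_cons !addrA lerD2r /cubic.
have -> : a.-1%:R = a%:R - 1 :> R by rewrite -subn1 natrB.
move: balance lt_ab; rewrite natrD -(ltr_nat R) => balance; rewrite -[b.+1]addn1 natrD.
set x := a%:R in balance *; set y := b%:R in balance * => lt_ab.
have : 0 <= (x - 1 - y) * (3 * (x + y) - 2 * k) by rewrite mulr_ge0 // subr_ge0; lra.
move=> h; rewrite -subr_ge0; apply: le_trans h _; rewrite le_eqVlt.
by apply/orP; left; apply/eqP; ring.
Qed.
End EqualParts.

(** * Minimal energy by symmetrization *)

Section Symmetrization.
Variables (R : realFieldType) (k : R) (T : finType).
Implicit Types (h : rel T) (x y z u w : T).

(* [h] is the adjacency relation of a graph with a loop added at each vertex.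
   For [k = 3 + 4 lambda / 3], up to the factor 8 and an additive constant, this
   bounds from below the contribution to d_4 - lambda d_3 of a vertex whose
   neighbourhood is that graph. *)
Definition local_energy h : R :=
  \sum_x \sum_y \sum_z ((h x y)%:R * (h x z)%:R * (2 - (h y z)%:R))
    - k * \sum_x \sum_y (h x y)%:R.

(** [u] becomes a twin of [w]; if [h] is reflexive, the two are adjacent afterwards. *)
Definition clone h u w : rel T :=
  fun x y => h (if x == u then w else x) (if y == u then w else y).

Lemma sum_delta (F : T -> R) w : \sum_x (x == w)%:R * F x = F w.
Proof.
rewrite (bigD1 w) //= eqxx mul1r big1 ?addr0 // => x /negPf ->.
by rewrite mul0r.
Qed.

(** The substitution replaces the value at [u] by a second copy of the value at [w]. Written as a
    weight [1 + d], the opposite substitution has weight [1 - d]. *)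
Lemma sum_merge (F : T -> R) u w :
  \sum_x F (if x == u then w else x) =
    \sum_x (1 + ((x == w)%:R - (x == u)%:R)) * F x.
Proof.
under [RHS]eq_bigr do rewrite mulrDl mul1r mulrBl.
rewrite big_split big_split /= sumrN !sum_delta.
rewrite (bigD1 u) //= eqxx [in RHS](bigD1 u) //=.
under eq_bigr => x /negPf -> do over.
by ring.
Qed.

(** The two clonings weight each variable by [1 + d] and [1 - d] respectively. In the sum of the two
    energies the terms of odd degree in [d] cancel, and those of degree two give the sum of
    squares. *)
Lemma local_energy_clone h u w : reflexive h -> symmetric h -> h u w ->
  local_energy (clone h u w) + local_energy (clone h w u) =
    2 * local_energy h - 2 * \sum_x ((h x w)%:R - (h x u)%:R) ^+ 2.
Proof.
move=> h_refl h_sym uw.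
pose d x : R := (x == w)%:R - (x == u)%:R.
have sum_d F : \sum_x d x * F x = F w - F u.
  by under eq_bigr do rewrite mulrBl; rewrite big_split /= sumrN !sum_delta.
pose S x y z : R := (h x y)%:R * (h x z)%:R * (2 - (h y z)%:R).
have E3 v1 v2 : \sum_x \sum_y \sum_z
      ((clone h v1 v2 x y)%:R * (clone h v1 v2 x z)%:R * (2 - (clone h v1 v2 y z)%:R))
   = \sum_x \sum_y \sum_z (1 + ((x == v2)%:R - (x == v1)%:R)) *
       (1 + ((y == v2)%:R - (y == v1)%:R)) * (1 + ((z == v2)%:R - (z == v1)%:R)) *
       S x y z.
  pose p x := if x == v1 then v2 else x.
  rewrite (sum_merge (fun x => \sum_y \sum_z S x (p y) (p z))).
  apply: eq_bigr => x _; rewrite (sum_merge (fun y => \sum_z S x y (p z))) mulr_sumr.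
  apply: eq_bigr => y _; rewrite (sum_merge (fun z => S x y z)) !mulr_sumr.
  by apply: eq_bigr => z _; rewrite !mulrA.
have E2 v1 v2 : \sum_x \sum_y (clone h v1 v2 x y)%:R =
    \sum_x \sum_y (1 + ((x == v2)%:R - (x == v1)%:R)) *
       (1 + ((y == v2)%:R - (y == v1)%:R)) * (h x y)%:R :> R.
  pose p x := if x == v1 then v2 else x.
  rewrite (sum_merge (fun x => \sum_y (h x (p y))%:R)).
  apply: eq_bigr => x _; rewrite (sum_merge (fun y => (h x y)%:R)) !mulr_sumr.
  by apply: eq_bigr => y _; rewrite !mulrA.
have wu : h w u by rewrite h_sym.
have Q3 : \sum_x \sum_y \sum_z
      ((clone h u w x y)%:R * (clone h u w x z)%:R * (2 - (clone h u w y z)%:R)) +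
    \sum_x \sum_y \sum_z
      ((clone h w u x y)%:R * (clone h w u x z)%:R * (2 - (clone h w u y z)%:R)) =
    2 * (\sum_x \sum_y \sum_z S x y z) - 2 * \sum_x ((h x w)%:R - (h x u)%:R) ^+ 2 :> R.
  (* Taking differences in two of the three arguments gives the sum of squares up to sign: negative
     for the two pairs containing the centre [x], positive for [y] and [z]. *)
  have -> : \sum_x ((h x w)%:R - (h x u)%:R) ^+ 2 =
     - (\sum_x d x * \sum_y d y * \sum_z S x y z)
     - (\sum_x d x * \sum_z d z * \sum_y S x y z)
     - (\sum_y d y * \sum_z d z * \sum_x S x y z) :> R.
    rewrite !sum_d /= -!sumrB -!sumrN -!big_split /=.
    apply: eq_bigr => x _; rewrite /S ![h w x]h_sym ![h u x]h_sym !h_refl uw wu.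
    by rewrite /=; ring.
  rewrite !E3 -!big_split /=.
  rewrite [\sum_x d x * \sum_y d y * _](_ :
    _ = \sum_x \sum_y \sum_z d x * d y * S x y z); last first.
    apply: eq_bigr => x _; rewrite mulr_sumr; apply: eq_bigr => y _.
    by rewrite !mulr_sumr; apply: eq_bigr => z _; rewrite mulrA.
  rewrite [\sum_x d x * \sum_z d z * _](_ :
    _ = \sum_x \sum_y \sum_z d x * d z * S x y z); last first.
    apply: eq_bigr => x _; rewrite exchange_big mulr_sumr; apply: eq_bigr => z _.
    by rewrite !mulr_sumr; apply: eq_bigr => y _; rewrite mulrA.
  rewrite [\sum_x d x * \sum_z d z * _](_ :
    _ = \sum_x \sum_y \sum_z d y * d z * S x y z); last first.
    rewrite exchange_big; apply: eq_bigr => y _.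
    rewrite exchange_big mulr_sumr; apply: eq_bigr => z _.
    by rewrite !mulr_sumr; apply: eq_bigr => x _; rewrite mulrA.
  rewrite -sumrN -!sumrB !mulr_sumr -sumrB.
  apply: eq_bigr => x _; rewrite -!big_split /= -sumrN -!sumrB !mulr_sumr -sumrB.
  apply: eq_bigr => y _; rewrite -!big_split /= -sumrN -!sumrB !mulr_sumr -sumrB.
  by apply: eq_bigr => z _; rewrite /d; ring.
have Q2 : \sum_x \sum_y (clone h u w x y)%:R + \sum_x \sum_y (clone h w u x y)%:R =
    2 * \sum_x \sum_y (h x y)%:R :> R.
  (* The pair sum contributes nothing, since [h] holds on all four pairs formed from [u] and [w]. *)
  have D0 : \sum_x d x * \sum_y d y * (h x y)%:R = 0.
    by rewrite !sum_d !h_refl uw wu /=; ring.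
  transitivity (2 * \sum_x \sum_y (h x y)%:R + 2 * \sum_x d x * \sum_y d y * (h x y)%:R : R);
    last by rewrite D0 mulr0 addr0.
  rewrite !E2 -big_split /= !mulr_sumr -big_split.
  apply: eq_bigr => x _ /=; rewrite !mulr_sumr -!big_split.
  by apply: eq_bigr => y _ /=; rewrite /d; ring.
rewrite /local_energy addrACA -opprD -mulrDr Q3 Q2 /S; ring.
Qed.

(** By transitivity the third factor is 1 wherever the first two are nonzero, so the triple sum is a
    sum of squared degrees, and the degree is the size of the class. *)
Lemma local_energy_equiv h : equivalence_rel h ->
  exists s : seq nat, [/\ all (leq 1) s, sumn s = #|T| &
    local_energy h = \sum_(a <- s) cubic k a].
Proof.
move=> h_eqv; have h_refl : reflexive h by move=> x; case: (h_eqv x x x).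
have h_rel : {in [set: T]%SET & &, equivalence_rel h} by move=> x y z _ _ _; exact: h_eqv.
pose P := equivalence_partition h [set: T]%SET.
have partP : finset.partition P [set: T]%SET by exact: equivalence_partitionP.
have card_block (A : {set T}) x : A \in P -> x \in A -> \sum_y (h x y)%:R = #|A|%:R :> R.
  move=> AP xA; rewrite -natr_sum -sum1_card [in RHS]big_mkcond /=; congr _%:R.
  apply: eq_bigr => y _.
  have -> : (y \in A) = h x y; last by case: (h x y).
  rewrite -(def_pblock _ AP xA); last by case/and3P: partP.
  by rewrite pblock_equivalence_partition ?inE.
exists [seq #|A| | A : {set T} <- enum P]; split.
- apply/allP => a /mapP[A]; rewrite mem_enum => AP ->; rewrite card_gt0.
  by case/and3P: partP => _ _; apply: contraNN => /eqP <-.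
- by rewrite sumnE big_map big_enum /= -(card_partition partP) cardsT.
rewrite big_map big_enum /=.
have -> : local_energy h = \sum_(x in [set: T]%SET)
    ((\sum_y (h x y)%:R) ^+ 2 - k * \sum_y (h x y)%:R).
  rewrite /local_energy mulr_sumr -sumrB [RHS]big_mkcond /=; apply: eq_bigr => x _;
    rewrite inE.
  congr (_ - _); rewrite expr2 big_distrlr; apply: eq_bigr => y _; apply: eq_bigr =>
    z _ /=.
  have [xy|] := boolP (h x y); last by rewrite !mul0r.
  have [xz|] := boolP (h x z); last by rewrite mulr0 mul0r.
  have -> : h y z by case: (h_eqv x y z) => _ /(_ xy) <-.
  by rewrite !mul1r -natrB.
rewrite (set_partition_big _ partP) /=; apply: eq_bigr => A AP.
rewrite (eq_bigr (fun _ => #|A|%:R ^+ 2 - k * #|A|%:R)); last first.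
  by move=> x xA; rewrite (card_block A x).
by rewrite sumr_const -mulr_natl /cubic; ring.
Qed.

(** At a minimum neither cloning lowers the energy, so the sum of squares in [local_energy_clone]
    vanishes: adjacent vertices are twins, which makes the relation transitive. *)
Lemma local_energy_ge h : (0 < #|T|)%N -> reflexive h -> symmetric h ->
  exists l, (1 <= l <= #|T|)%N /\
    \sum_(1 <= i < l.+1) cubic k (part #|T| l i) <= local_energy h.
Proof.
move=> T0 h_refl h_sym.
(* Relations are coded by finite functions, so that a minimum exists. *)
pose rel_of (f : {ffun T * T -> bool}) : rel T := fun x y => f (x, y).
pose ok (f : {ffun T * T -> bool}) :=
  [forall x, rel_of f x x] && [forall x, forall y, rel_of f x y == rel_of f y x].
pose code (g : rel T) := [ffun p : T * T => g p.1 p.2].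
have codeK g : rel_of (code g) = g by apply/boolp.funext => x; apply/boolp.funext => y;
  rewrite /rel_of ffunE.
have okE g : reflexive g -> symmetric g -> ok (code g).
  move=> g_refl g_sym; rewrite /ok codeK; apply/andP; split; apply/forallP => x //.
  by apply/forallP => y; rewrite g_sym.
have [f /andP[/forallP f_refl /forallP f_sym] min_f] :=
  arg_minP (fun f => local_energy (rel_of f)) (okE h h_refl h_sym).
have min_h : local_energy (rel_of f) <= local_energy h.
  by rewrite -[X in _ <= local_energy X]codeK; apply: min_f; exact: okE.
set g := rel_of f in f_refl f_sym min_f min_h.
have {}f_sym : symmetric g by move=> x y; apply/eqP/(forallP (f_sym x)).
have g_twin u w x : g u w -> g x u = g x w.
  move=> uw.
  have clone_ge v1 v2 : local_energy g <= local_energy (clone g v1 v2).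
    rewrite -(codeK (clone g v1 v2)); apply: min_f; apply: okE.
      by move=> y; exact: f_refl.
    by move=> y z; exact: f_sym.
  have := lerD (clone_ge u w) (clone_ge w u).
  rewrite local_energy_clone //.
  set D := \sum_x _ => leD.
  have D0 : D = 0.
    by apply/le_anti/andP; split; [lra | apply: sumr_ge0 => y _; exact: sqr_ge0].
  have /eqP := psumr_eq0P (fun y _ => sqr_ge0 _) D0 (i := x) isT.
  rewrite sqrf_eq0 subr_eq0 eqr_nat.
  by case: (g x u); case: (g x w).
have g_eqv : equivalence_rel g.
  by move=> x y z; split; [exact: f_refl | move=> xy; rewrite f_sym (f_sym y);
    exact: g_twin].
have [s [s_pos s_sum gE]] := local_energy_equiv g_eqv.
have [|l [ls le_l]] := sum_cubic_ge_part k _ s_pos; first by rewrite s_sum.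
exists l; rewrite -s_sum; split=> //.
by apply: le_trans le_l _; rewrite -gE.
Qed.
End Symmetrization.

(** * Nonbacktracking walks in regular graphs *)

Definition valency (T : finType) (e : rel T) (x : T) : nat := #|[pred y | e x y]|.

Lemma valencyE (T : finType) (e : rel T) x : valency e x = (\sum_y e x y)%N.
Proof.
by rewrite /valency -sum1_card big_mkcond; apply: eq_bigr => y _; rewrite inE;
  case: (e x y).
Qed.

Definition paths2 (T : finType) (e : rel T) : nat :=
  (\sum_x \sum_y \sum_z [&& e x y, e y z & x != z])%N.

(** Nonbacktracking walks; the end [w] may be the start [x], which is the case of a triangle. *)
Definition paths3 (T : finType) (e : rel T) : nat :=
  (\sum_x \sum_y \sum_z \sum_w
     [&& e x y, e y z, e z w, x != z & y != w])%N.

Section RegularCounts.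
Variables (T : finType) (e : rel T) (r : nat).
Hypotheses (e_sym : symmetric e) (e_irr : irreflexive e).
Hypothesis e_reg : forall x, valency e x = r.

Lemma sum_adj x : (\sum_y (e x y : nat) = r)%N.
Proof. by rewrite -valencyE e_reg. Qed.

Lemma sum_adj_neq x y : e x y -> (\sum_z [&& e y z & x != z] = r - 1)%N.
Proof.
move=> xy; rewrite -(sum_adj y) [in RHS](bigD1 x) //= e_sym xy addKn.
rewrite (bigD1 x) //= eqxx andbF add0n; apply: eq_bigr => z zx.
by rewrite eq_sym zx andbT.
Qed.

Lemma paths2E : paths2 e = (#|T| * (r * (r - 1)))%N.
Proof.
rewrite /paths2 -sum_nat_const; apply: eq_bigr => x _.
rewrite -{1}(sum_adj x) big_distrl /=; apply: eq_bigr => y _.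
have [xy|] := boolP (e x y); last by rewrite big1.
by rewrite mul1n -(sum_adj_neq xy).
Qed.

Lemma paths3E : paths3 e = (#|T| * (r * (r - 1) ^ 2))%N.
Proof.
rewrite expnS expn1 !mulnA -[(_ * r * _)%N]mulnA -paths2E /paths3 /paths2.
rewrite big_distrl /=; apply: eq_bigr => x _.
rewrite big_distrl /=; apply: eq_bigr => y _.
rewrite big_distrl /=; apply: eq_bigr => z _.
have [xy|] := boolP (e x y); last by rewrite big1.
have [yz|] := boolP (e y z); last by rewrite big1.
have [xz|] := boolP (x != z); last by rewrite big1 // => w _; rewrite /= andbF.
by rewrite mul1n -(sum_adj_neq yz).
Qed.

Lemma triangles_le : (triangles e <= #|T| * (r * (r - 1)))%N.
Proof.
rewrite -paths2E; apply: leq_sum => x _.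
apply: leq_sum => y _.
apply: leq_sum => z _.
case: (x =P z) => [<-|_]; first by rewrite e_irr !andbF.
by case: (e x y); case: (e y z); case: (e z x).
Qed.

Lemma trianglesE4 : triangles e =
  (\sum_x \sum_y \sum_z \sum_w
     [&& e x y, e y z, e z w, x != z & y != w] * (w == x))%N.
Proof.
apply: eq_bigr => x _.
apply: eq_bigr => y _.
apply: eq_bigr => z _.
rewrite (bigD1 x) //= eqxx muln1 big1 ?addn0; last by move=> w /negPf ->; rewrite muln0.
case: (x =P z) => [<-|_]; first by rewrite e_irr !andbF.
by case: (y =P x) => [->|_]; rewrite ?e_irr ?andbT.
Qed.

(** A nonbacktracking walk of length 3 is a triangle if its ends coincide and a square if they are
    adjacent; the two cases exclude each other. *)
Lemma squares_triangles_le :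
  (squares e + triangles e <= #|T| * (r * (r - 1) ^ 2))%N.
Proof.
rewrite -paths3E trianglesE4 /squares /paths3.
rewrite -big_split; apply: leq_sum => x _ /=.
rewrite -big_split; apply: leq_sum => y _ /=.
rewrite -big_split; apply: leq_sum => z _ /=.
rewrite -big_split; apply: leq_sum => w _ /=.
case: (w =P x) => [->|_]; first by rewrite e_irr !andbF muln1.
by rewrite muln0 addn0; case: (e x y); case: (e y z); case: (e z w); case: (e w x).
Qed.

Lemma triangles_eq :
  (forall x y z, e x y -> e y z -> x != z -> e z x) ->
  triangles e = (#|T| * (r * (r - 1)))%N.
Proof.
move=> closed; rewrite -paths2E; apply: eq_bigr => x _.
apply: eq_bigr => y _.
apply: eq_bigr => z _.
have [xy|//] := boolP (e x y); have [yz|//] := boolP (e y z).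
have [<-|xz] := eqVneq x z; first by rewrite e_irr.
by rewrite /= (closed _ _ _ xy yz xz).
Qed.

(** Equality case, met by complete graphs and by [K_{r,r}]. *)
Lemma squares_triangles_eq :
  (forall x y z w, e x y -> e y z -> e z w -> x != z -> y != w -> w != x -> e w x) ->
  (squares e + triangles e)%N = (#|T| * (r * (r - 1) ^ 2))%N.
Proof.
move=> closed; rewrite -paths3E trianglesE4 /squares /paths3.
rewrite -big_split; apply: eq_bigr => x _ /=.
rewrite -big_split; apply: eq_bigr => y _ /=.
rewrite -big_split; apply: eq_bigr => z _ /=.
rewrite -big_split; apply: eq_bigr => w _ /=.
have [->|wx] := eqVneq w x; first by rewrite e_irr !andbF muln1.
rewrite muln0 addn0.
have [xy|//] := boolP (e x y); have [yz|//] := boolP (e y z).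
have [zw|//] := boolP (e z w).
have [xz|//] := boolP (x != z); last by rewrite !andbF.
have [yw|//] := boolP (y != w); last by rewrite !andbF.
by rewrite (closed x y z w).
Qed.

End RegularCounts.

(** * From the energy of neighbourhoods to squares *)

Section LocalEnergy.
Variables (R : realFieldType) (k : R).

Lemma sum_delta_r (T : finType) (F : T -> R) (w : T) : \sum_x F x * (w == x)%:R = F w.
Proof.
rewrite -[RHS]sum_delta; apply: eq_bigr => x _.
by rewrite mulrC eq_sym.
Qed.

(** The loops are split off: each of the coincidences [y = z], [x = y], [x = z] contributes the
    number of ordered edges, and [x = y = z] the number of vertices. *)
Lemma local_energyE (T : finType) (e : rel T) : symmetric e -> irreflexive e ->
  local_energy k (fun x y => (x == y) || e x y) =
    2 * \sum_x \sum_y \sum_z [&& e x y, e x z & y != z]%:R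
    - \sum_x \sum_y \sum_z [&& e x y, e x z & e y z]%:R
    + (3 - k) * \sum_x \sum_y (e x y)%:R + (1 - k) * #|T|%:R.
Proof.
move=> e_sym e_irr; rewrite /local_energy.
pose E : R := \sum_x \sum_y (e x y)%:R.
have -> : \sum_x \sum_y ((x == y) || e x y)%:R = #|T|%:R + E.
  rewrite -sum1_card natr_sum -big_split; apply: eq_bigr => x _ /=.
  rewrite -[1]/((fun _ : T => 1) x) -[X in X + _](sum_delta_r _ x) -big_split;
    apply: eq_bigr => y _ /=.
  by case: eqP => [->|_]; rewrite ?e_irr /= ?mul1r ?mulr0 ?addr0 ?add0r.
have -> : \sum_x \sum_y \sum_z (((x == y) || e x y)%:R * ((x == z) || e x z)%:R
      * (2 - ((y == z) || e y z)%:R)) =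
   2 * (\sum_x \sum_y \sum_z [&& e x y, e x z & y != z]%:R)
   - \sum_x \sum_y \sum_z [&& e x y, e x z & e y z]%:R
   + \sum_x \sum_y \sum_z (e x y)%:R * (y == z)%:R
   + \sum_x \sum_z \sum_y (e x z)%:R * (x == y)%:R
   + \sum_x \sum_y \sum_z (e x y)%:R * (x == z)%:R
   + \sum_(x : T) \sum_y \sum_z (x == y)%:R * (x == z)%:R :> R.
  rewrite !mulr_sumr -sumrN -!big_split; apply: eq_bigr => x _ /=.
  rewrite [X in _ + X + _ + _]exchange_big.
  rewrite !mulr_sumr -sumrN -!big_split; apply: eq_bigr => y _ /=.
  rewrite !mulr_sumr -sumrN -!big_split; apply: eq_bigr => z _ /=.
  have [yz|yz] := eqVneq y z; first rewrite -{}yz.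
    by have [<-|xy] := eqVneq x y; rewrite ?e_irr /=; [ring | case: (e x y) => /=; ring].
  have [xy|xy] := eqVneq x y; first rewrite -{}xy in yz *.
    by rewrite e_irr (negPf yz) /=; case: (e x z) => /=; ring.
  have [xz|xz] := eqVneq x z; first rewrite -{}xz in yz *.
    by rewrite e_irr [e y x]e_sym /=; case: (e x y) => /=; ring.
  by case: (e x y); case: (e x z); case: (e y z) => /=; ring.
under [X in _ + X + _ + _ + _ - _]eq_bigr do under eq_bigr do rewrite sum_delta_r.
under [X in _ + X + _ + _ - _]eq_bigr do under eq_bigr do rewrite sum_delta_r.
under [X in _ + X + _ - _]eq_bigr do under eq_bigr do rewrite sum_delta_r.
under [X in _ + X - _]eq_bigr do under eq_bigr do rewrite sum_delta_r.
have -> : \sum_(x : T) \sum_y (x == y)%:R = #|T|%:R :> R.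
  rewrite -sum1_card natr_sum; apply: eq_bigr => x _.
  by rewrite -[RHS](sum_delta_r (fun=> 1) x); apply: eq_bigr => y _; rewrite mul1r.
by rewrite -/E; ring.
Qed.

End LocalEnergy.

Section SquareBound.
Variables (R : realFieldType) (k : R) (T : finType) (e : rel T) (r : nat).
Hypotheses (e_sym : symmetric e) (e_irr : irreflexive e).
Hypothesis e_reg : forall x, valency e x = r.
Hypothesis r_gt0 : (0 < r)%N.

(** The energy bound for the graph induced on the [r] neighbours of [v], with sums over the
    neighbourhood rewritten as sums over all vertices. *)
Lemma local_energy_nbhd v :
  exists l, (1 <= l <= r)%N /\
    \sum_(1 <= i < l.+1) cubic k (part r l i) + (k - 1) * r%:R <=
    2 * \sum_x \sum_y \sum_z [&& e v x, e v y, e v z, e x y, e x z & y != z]%:R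
    - \sum_x \sum_y \sum_z [&& e v x, e v y, e v z, e x y, e x z & e y z]%:R
    - (k - 3) * \sum_x \sum_y [&& e v x, e v y & e x y]%:R.
Proof.
pose N := [pred y | e v y]; pose f (i : 'I_#|N|) : T := enum_val i.
pose eN : rel 'I_#|N| := fun i j => e (f i) (f j).
have cardN : #|N| = r by exact: e_reg.
have [||| l [lr le_l]] := @local_energy_ge R k _ (fun x y => (x == y) || eN x y).
- by rewrite card_ord cardN.
- by move=> x; rewrite eqxx.
- by move=> x y; rewrite eq_sym /eN e_sym.
exists l; move: lr le_l.
rewrite local_energyE; [|by move=> x y; rewrite /eN e_sym|by move=> x; rewrite /eN e_irr].
have sum_f (F : T -> R) : \sum_x F (f x) = \sum_x (e v x)%:R * F x.
  rewrite /f -(@big_enum_val _ _ _ _ N F) big_mkcond; apply: eq_bigr => x _ /=.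
  by rewrite inE; case: (e v x); rewrite ?mul1r ?mul0r.
have sum_f3 (F : T -> T -> T -> R) : \sum_x \sum_y \sum_z F (f x) (f y) (f z) =
    \sum_x \sum_y \sum_z (e v x)%:R * (e v y)%:R * (e v z)%:R * F x y z.
  rewrite (sum_f (fun x => \sum_y \sum_z F x (f y) (f z))).
  apply: eq_bigr => x _; rewrite (sum_f (fun y => \sum_z F x y (f z))) mulr_sumr.
  apply: eq_bigr => y _; rewrite sum_f !mulr_sumr.
  by apply: eq_bigr => z _; rewrite !mulrA.
have -> : \sum_x \sum_y \sum_z [&& eN x y, eN x z & y != z]%:R =
   \sum_x \sum_y \sum_z [&& e v x, e v y, e v z, e x y, e x z & y != z]%:R :> R.
  under eq_bigr do under eq_bigr do under eq_bigr do rewrite -(inj_eq enum_val_inj).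
  rewrite (sum_f3 (fun x y z => [&& e x y, e x z & y != z]%:R)).
  apply: eq_bigr => x _; apply: eq_bigr => y _; apply: eq_bigr => z _.
  by case: (e v x); case: (e v y); case: (e v z); rewrite ?mul1r ?mulr0 ?mul0r.
have -> : \sum_x \sum_y \sum_z [&& eN x y, eN x z & eN y z]%:R =
   \sum_x \sum_y \sum_z [&& e v x, e v y, e v z, e x y, e x z & e y z]%:R :> R.
  rewrite (sum_f3 (fun x y z => [&& e x y, e x z & e y z]%:R)).
  apply: eq_bigr => x _; apply: eq_bigr => y _; apply: eq_bigr => z _.
  by case: (e v x); case: (e v y); case: (e v z); rewrite ?mul1r ?mulr0 ?mul0r.
have -> : \sum_x \sum_y (eN x y)%:R = \sum_x \sum_y [&& e v x, e v y & e x y]%:R :> R.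
  rewrite (sum_f (fun x => \sum_y (e x (f y))%:R)); apply: eq_bigr => x _.
  rewrite (sum_f (fun y => (e x y)%:R)) mulr_sumr; apply: eq_bigr => y _.
  by case: (e v x); case: (e v y); rewrite ?mul1r ?mulr0 ?mul0r.
rewrite card_ord cardN => lr le_l; split=> //; move: le_l; lra.
Qed.

(* The first sum counts a square once for each of its two diagonals that is an
   edge, and the second one counts the squares for which both are. *)
Lemma squares_ge :
  2 * (\sum_v \sum_x \sum_y \sum_z
         [&& e v x, e v y, e v z, e x y, e x z & y != z]%:R)
  - \sum_v \sum_x \sum_y \sum_z
         [&& e v x, e v y, e v z, e x y, e x z & e y z]%:R
  <= (squares e)%:R :> R.
Proof.
pose A v x y z : R := [&& e v x, e v y, e v z, e x y, e x z & y != z]%:R.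
have AE : \sum_v \sum_x \sum_y \sum_z A v x y z = \sum_v \sum_y \sum_x \sum_z A v x y z.
  by apply: eq_bigr => v _; rewrite exchange_big.
(* The roles of the diagonals are exchanged: in the square [v], [y], [x], [z] the diagonal required
   to be an edge is now [y z] instead of [v x]. Inclusion and exclusion then applies to each
   square. *)
have AE' : \sum_v \sum_x \sum_y \sum_z A v x y z = \sum_v \sum_y \sum_x \sum_z A y z v x.
  rewrite [RHS]exchange_big /=; apply: eq_bigr => y _.
  under [RHS]eq_bigr do rewrite exchange_big.
  by rewrite [RHS]exchange_big.
have -> : (squares e)%:R = \sum_v \sum_y \sum_x \sum_z
   ([&& e v y, e y x, e x z & e z v] && ((v != x) && (y != z)))%:R :> R.
  rewrite natr_sum; apply: eq_bigr => ? _; rewrite natr_sum; apply: eq_bigr => ? _.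
  by rewrite natr_sum; apply: eq_bigr => ? _; rewrite natr_sum; apply: eq_bigr => ? _.
rewrite mulr_natl mulr2n {1}AE AE'.
rewrite [X in _ - X](_ : _ = \sum_v \sum_y \sum_x \sum_z
  [&& e v x, e v y, e v z, e x y, e x z & e y z]%:R); last first.
  by apply: eq_bigr => v _; rewrite exchange_big.
rewrite -sumrN -!big_split; apply: ler_sum => v _ /=.
rewrite -sumrN -!big_split; apply: ler_sum => y _ /=.
rewrite -sumrN -!big_split; apply: ler_sum => x _ /=.
rewrite -sumrN -!big_split; apply: ler_sum => z _ /=.
rewrite /A [e y v]e_sym [e y x]e_sym [e z v]e_sym [e z x]e_sym.
have vx : e v x -> v != x by apply: contraTneq => ->; rewrite e_irr.
have yz : e y z -> y != z by apply: contraTneq => ->; rewrite e_irr.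
case: (e v y); last by rewrite ?andbF /=; lra.
case: (e x y); last by rewrite ?andbF /=; lra.
case: (e v z); last by rewrite ?andbF /=; lra.
case: (e x z); last by rewrite ?andbF /=; lra.
move: vx yz; case: (e v x) => [/(_ isT) ->|_]; case: (e y z) => [/(_ isT) ->|_] /=;
  try lra.
all: by case: (_ != _) => /=; try case: (_ != _) => /=; lra.
Qed.

(** The bounds at the vertices are added up; adjacent pairs in the neighbourhoods count the
    triangles. *)
Lemma squares_triangles_ge :
  exists l, (1 <= l <= r)%N /\
    #|T|%:R * (\sum_(1 <= i < l.+1) cubic k (part r l i) + (k - 1) * r%:R) <=
    (squares e)%:R - (k - 3) * (triangles e)%:R.
Proof.
pose E l := \sum_(1 <= i < l.+1) cubic k (part r l i).
(* The [l] found at a vertex depends on the vertex, so it is replaced by one minimizing [E] over all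
   of them. *)
pose p := [arg min_(l < Ordinal r_gt0) E l.+1]%O.
exists p.+1; rewrite ltn_ord; split=> //.
have min_p l : (1 <= l <= r)%N -> E p.+1 <= E l.
  rewrite /p; case: arg_minP => // q _ min_q /andP[l1 lr].
  have lr' : (l.-1 < r)%N by lia.
  by have := min_q (Ordinal lr') isT; rewrite /= prednK.
pose D v : R :=
    2 * (\sum_x \sum_y \sum_z [&& e v x, e v y, e v z, e x y, e x z & y != z]%:R)
    - \sum_x \sum_y \sum_z [&& e v x, e v y, e v z, e x y, e x z & e y z]%:R
    - (k - 3) * \sum_x \sum_y [&& e v x, e v y & e x y]%:R.
have le_D v : E p.+1 + (k - 1) * r%:R <= D v.
  have [l [lr le_l]] := local_energy_nbhd v.
  by apply: le_trans le_l; rewrite lerD2r min_p.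
apply: (@le_trans _ _ (\sum_v D v)).
  rewrite -sum1_card natr_sum mulr_suml; apply: ler_sum => v _.
  by rewrite mul1r.
rewrite !sumrB -!mulr_sumr; apply: lerB; first exact: squares_ge.
rewrite le_eqVlt; apply/orP; left; apply/eqP; congr (_ * _).
rewrite natr_sum; apply: eq_bigr => v _; rewrite natr_sum exchange_big.
apply: eq_bigr => x _ /=; rewrite natr_sum; apply: eq_bigr => y _.
by rewrite [e y v]e_sym [e y x]e_sym; case: (e v x); case: (e v y); case: (e x y).
Qed.
End SquareBound.

(** * Graph constructions *)

Section Bijection.
Variables (T T' : finType) (f : T -> T') (e : rel T').
Hypothesis f_bij : bijective f.
Local Open Scope nat_scope.

Lemma sum_bij (F : T' -> nat) : \sum_x F x = \sum_x F (f x).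
Proof. by rewrite (reindex f) //; exact: onW_bij. Qed.

Lemma valency_bij x : valency (relpre f e) x = valency e (f x).
Proof. by rewrite !valencyE sum_bij. Qed.

Lemma triangles_bij : triangles (relpre f e) = triangles e.
Proof.
rewrite /triangles sum_bij; apply: eq_bigr => x _.
by rewrite sum_bij; apply: eq_bigr => y _; rewrite sum_bij.
Qed.

Lemma squares_bij : squares (relpre f e) = squares e.
Proof.
have f_inj := bij_inj f_bij.
rewrite /squares sum_bij; apply: eq_bigr => x _.
rewrite sum_bij; apply: eq_bigr => y _; rewrite sum_bij; apply: eq_bigr => z _.
by rewrite sum_bij; apply: eq_bigr => w _; rewrite !inj_eq.
Qed.

End Bijection.

(** * Disjoint copies and disjoint unions *)

Section Copies.
Variables (T K : finType) (e : rel T).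
Local Open Scope nat_scope.

Definition copies : rel (T * K) := fun p q => e p.1 q.1 && (p.2 == q.2).

Lemma sum_prod (F : T * K -> nat) : \sum_p F p = \sum_x \sum_i F (x, i).
Proof. by rewrite pair_bigA; apply: eq_bigr => -[]. Qed.

Lemma sum_copies (F : T * K -> nat) i :
  (forall p, p.2 != i -> F p = 0) -> \sum_p F p = \sum_x F (x, i).
Proof.
move=> F0; rewrite sum_prod.
apply: eq_bigr => x _; rewrite (bigD1 i) //= big1 ?addn0 // => j ji.
exact: F0.
Qed.

Lemma valency_copies p : valency copies p = valency e p.1.
Proof.
rewrite !valencyE (@sum_copies _ p.2) => [|q qp].
  by apply: eq_bigr => y _; rewrite /copies eqxx andbT.
by rewrite /copies eq_sym (negPf qp) andbF.
Qed.

Lemma triangles_copies : triangles copies = triangles e * #|K|.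
Proof.
rewrite /triangles sum_prod.
rewrite big_distrl /=; apply: eq_bigr => x _.
rewrite mulnC -sum_nat_const; apply: eq_bigr => i _.
rewrite (@sum_copies _ i) => [|q qi]; last first.
  by rewrite big1 // => z _; rewrite /copies /= eq_sym (negPf qi) andbF.
apply: eq_bigr => y _; rewrite (@sum_copies _ i) => [|q qi].
  by apply: eq_bigr => z _; rewrite /copies /= !eqxx !andbT.
by rewrite /copies /= [i == q.2]eq_sym (negPf qi) !andbF.
Qed.

Lemma squares_copies : squares copies = squares e * #|K|.
Proof.
rewrite /squares sum_prod.
rewrite big_distrl /=; apply: eq_bigr => x _.
rewrite mulnC -sum_nat_const; apply: eq_bigr => i _.
rewrite (@sum_copies _ i) => [|q qi]; last first.
  by rewrite big1 // => z _; rewrite big1 // => w _;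
    rewrite /copies /= eq_sym (negPf qi) andbF.
apply: eq_bigr => y _; rewrite (@sum_copies _ i) => [|q qi]; last first.
  by rewrite big1 // => w _; rewrite /copies /= [i == q.2]eq_sym (negPf qi) !andbF.
apply: eq_bigr => z _; rewrite (@sum_copies _ i) => [|q qi]; last first.
  by rewrite /copies /= [i == q.2]eq_sym (negPf qi) !andbF.
apply: eq_bigr => w _; rewrite /copies /= !eqxx !andbT.
by rewrite -!pair_eqE /= !eqxx !andbT.
Qed.
End Copies.

Section Sum.
Variables (T1 T2 : finType) (e1 : rel T1) (e2 : rel T2).
Local Open Scope nat_scope.

Definition sum_rel : rel (T1 + T2) := fun p q =>
  match p, q with
  | inl x, inl y => e1 x y
  | inr x, inr y => e2 x y
  | _, _ => false
  end.

Lemma valency_sum p : valency sum_rel p =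
  match p with inl x => valency e1 x | inr x => valency e2 x end.
Proof.
rewrite valencyE big_sumType /=; case: p => x /=; rewrite valencyE.
  by rewrite [X in _ + X]big1 ?addn0.
by rewrite big1.
Qed.

Lemma triangles_sum : triangles sum_rel = triangles e1 + triangles e2.
Proof.
rewrite /triangles big_sumType /=; congr (_ + _); apply: eq_bigr => x _.
  rewrite big_sumType /= [X in _ + X]big1 ?addn0 => [|y _]; last by rewrite big1.
  apply: eq_bigr => y _; rewrite big_sumType /= [X in _ + X]big1 ?addn0 // => z _.
  by rewrite andbF.
rewrite big_sumType /= big1 ?add0n => [|y _]; last by rewrite big1.
apply: eq_bigr => y _; rewrite big_sumType /= big1 ?add0n // => z _.
by rewrite andbF.
Qed.

Lemma squares_sum : squares sum_rel = squares e1 + squares e2.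
Proof.
rewrite /squares big_sumType /=; congr (_ + _); apply: eq_bigr => x _.
  rewrite big_sumType /= [X in _ + X]big1 ?addn0 => [|y _]; last first.
    by rewrite big1 // => z _; rewrite big1.
  apply: eq_bigr => y _; rewrite big_sumType /= [X in _ + X]big1 ?addn0 => [|z _];
    last first.
    by rewrite big1 // => w _; rewrite andbF.
  apply: eq_bigr => z _; rewrite big_sumType /= [X in _ + X]big1 ?addn0 // => w _.
  by rewrite !andbF.
rewrite big_sumType /= big1 ?add0n => [|y _]; last first.
  by rewrite big1 // => z _; rewrite big1.
apply: eq_bigr => y _; rewrite big_sumType /= big1 ?add0n => [|z _]; last first.
  by rewrite big1 // => w _; rewrite andbF.
apply: eq_bigr => z _; rewrite big_sumType /= big1 ?add0n // => w _.
by rewrite !andbF.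
Qed.
End Sum.

(** * Unions of two graphs without mixed cycles *)

Section Union.
Variables (T : finType) (X Y : eqType) (a b : rel T) (g : T -> X) (h : T -> Y).
Hypotheses (a_h : forall x y, a x y -> h x = h y)
           (b_g : forall x y, b x y -> g x = g y)
           (a_g : forall x y, a x y -> g x <> g y)
           (b_h : forall x y, b x y -> h x <> h y).
Hypothesis aabb : forall x y z w, a x y -> a y z -> b z w -> b w x -> x = z.
Hypothesis abab : forall x y z w, a x y -> b y z -> a z w -> b w x -> False.
Let ab : rel T := fun x y => a x y || b x y.
Local Open Scope nat_scope.

Variant edge_spec x y : bool -> bool -> Prop :=
  | EdgeA of h x = h y & g x <> g y : edge_spec x y true false
  | EdgeB of g x = g y & h x <> h y : edge_spec x y false true
  | NoEdge : edge_spec x y false false.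

Lemma edgeP x y : edge_spec x y (a x y) (b x y).
Proof.
have [axy|_] := boolP (a x y); have [bxy|_] := boolP (b x y).
- by case: (a_g axy (b_g bxy)).
- by constructor; [exact: a_h | exact: a_g].
- by constructor; [exact: b_g | exact: b_h].
- by constructor.
Qed.

Lemma union_disjoint x y : (a x y || b x y : nat) = a x y + b x y.
Proof.
have [ax|] := boolP (a x y); have [bx|] := boolP (b x y) => //.
by case: (a_g ax (b_g bx)).
Qed.

Lemma valency_union x : valency ab x = valency a x + valency b x.
Proof.
by rewrite !valencyE -big_split; apply: eq_bigr => y _; exact: union_disjoint.
Qed.

(** An [a]-edge changes [g] and keeps [h], a [b]-edge does the opposite. Around a mixed triangle one
    of the two would change exactly once. *)
Lemma triangles_union : triangles ab = triangles a + triangles b.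
Proof.
rewrite /triangles -big_split; apply: eq_bigr => x _ /=.
rewrite -big_split; apply: eq_bigr => y _ /=.
rewrite -big_split; apply: eq_bigr => z _ /=; rewrite /ab.
case: (edgeP x y) => [hxy gxy|gxy hxy|] //=;
  case: (edgeP y z) => [hyz gyz|gyz hyz|] //=;
  case: (edgeP z x) => [hzx gzx|gzx hzx|] //=; congruence.
Qed.

(** Three edges of one kind and one of the other are impossible as for triangles. The pattern [aabb]
    makes two opposite vertices equal, and [abab] is excluded by hypothesis. *)
Lemma squares_union : squares ab = squares a + squares b.
Proof.
rewrite /squares -big_split; apply: eq_bigr => x _ /=.
rewrite -big_split; apply: eq_bigr => y _ /=.
rewrite -big_split; apply: eq_bigr => z _ /=.
rewrite -big_split; apply: eq_bigr => w _ /=; rewrite /ab.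
have [->|xz] := eqVneq x z; first by rewrite /= !andbF.
have [->|yw] := eqVneq y w; first by rewrite /= !andbF.
rewrite !andbT.
(* Both patterns are needed in all their rotations. *)
have := (@aabb x y z w, @aabb y z w x, @aabb z w x y, @aabb w x y z).
have := (@abab x y z w, @abab y z w x).
case: (edgeP x y) => [hxy gxy|gxy hxy|] //=;
  case: (edgeP y z) => [hyz gyz|gyz hyz|] //=;
  case: (edgeP z w) => [hzw gzw|gzw hzw|] //=;
  case: (edgeP w x) => [hwx gwx|gwx hwx|] //=.
all: move=> [i1 i2] [[[j1 j2] j3] j4].
all: try by (exfalso; congruence).
all: try by case: i1.
all: try by case: i2.
all: try by case/eqP: xz; exact: j1.
all: try by case/eqP: xz; rewrite j3.
all: try by case/eqP: yw; exact: j2.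
all: try by case/eqP: yw; rewrite j4.
Qed.

End Union.

(** * The twisted product *)

Section TwistedProduct.
Variables (G H : simple_graph) (p : nat).
Hypotheses (p_prime : prime p) (ltGp : (#|G| < p)%N) (ltHp : (#|H| < p)%N).

Let phi (T : finType) (x : T) : 'F_p := (enum_rank x)%:R.

Let phi_inj (T : finType) : (#|T| < p)%N -> injective (@phi T).
Proof.
move=> ltTp x y /(congr1 val); rewrite /= !val_Fp_nat //.
rewrite !modn_small; try by apply: ltn_trans (ltn_ord _) _.
by move/val_inj/enum_rank_inj.
Qed.

(** Coordinates in which an [H]-edge moves only the first component: the twisted difference is
    constant along it. *)
Let twist (x : G * H * 'F_p) : H * (G * 'F_p) :=
  (x.1.2, (x.1.1, x.2 - phi x.1.2 * phi x.1.1)).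

Let twist_bij : bijective twist.
Proof.
exists (fun y => (y.2.1, y.1, y.2.2 + phi y.1 * phi y.2.1)) => [[[g h] z]|[h [g z]]];
  by rewrite /twist /= ?subrK ?addrK.
Qed.

Let unassoc (x : G * H * 'F_p) : G * (H * 'F_p) := (x.1.1, (x.1.2, x.2)).

Let unassoc_bij : bijective unassoc.
Proof. by exists (fun y => (y.1, y.2.1, y.2.2)) => [[[g h] z]|[g [h z]]]. Qed.

Let a := relpre unassoc (copies (K := (H * 'F_p)%type) (@adj G)).
Let b := relpre twist (copies (K := (G * 'F_p)%type) (@adj H)).

(* A step along [H] from [h] to [h'] over [g] adds [(phi h' - phi h) * phi g] to
   the third coordinate, so that a walk alternating between [G] and [H] around a
   rectangle changes the third coordinate by a nonzero amount. *)
Definition twisted_adj : rel (G * H * 'F_p) := fun x y => a x y || b x y.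

Lemma twisted_sym : symmetric twisted_adj.
Proof.
move=> x y; rewrite /twisted_adj /a /b /copies /= adj_sym [in LHS]eq_sym.
by rewrite [adj x.1.2 _]adj_sym [(x.1.1, _) == _]eq_sym.
Qed.

Lemma twisted_irr : irreflexive twisted_adj.
Proof. by move=> x; rewrite /twisted_adj /a /b /copies /= !adj_irr. Qed.

Definition twisted_product := SimpleGraph twisted_sym twisted_irr.

Let a_h x y : a x y -> x.1.2 = y.1.2.
Proof. by move=> /andP[_ /eqP[]]. Qed.
Let b_g x y : b x y -> x.1.1 = y.1.1.
Proof. by move=> /andP[_ /eqP[]]. Qed.
Let a_g x y : a x y -> x.1.1 <> y.1.1.
Proof. by move=> /andP[xy _] E; move: xy; rewrite /= E adj_irr. Qed.
Let b_h x y : b x y -> x.1.2 <> y.1.2.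
Proof. by move=> /andP[xy _] E; move: xy; rewrite /= E adj_irr. Qed.

Let b_twist x y : b x y ->
  x.2 - phi x.1.2 * phi x.1.1 = y.2 - phi y.1.2 * phi y.1.1.
Proof. by move=> /andP[_ /eqP E]; exact: (congr1 snd E). Qed.

Let aabb x y z w : a x y -> a y z -> b z w -> b w x -> x = z.
Proof.
move=> /andP[_ /eqP[h1 z1]] /andP[_ /eqP[h2 z2]] /b_g g1 /b_g g2.
by rewrite [x]surjective_pairing [x.1]surjective_pairing z1 z2 h1 h2 -g2 -g1
  -!surjective_pairing.
Qed.

Let abab x y z w : a x y -> b y z -> a z w -> b w x -> False.
Proof.
move=> axy byz azw bwx; have nh := b_h bwx; have ng := a_g axy.
have g1 := b_g byz; have g2 := b_g bwx; have k1 := b_twist byz; have k2 := b_twist bwx.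
move: axy azw => /andP[_ /eqP[h1 z1]] /andP[_ /eqP[h2 z2]].
rewrite -g1 h2 z2 -h1 -z1 in k1; rewrite g2 in k2.
(* The total twist around the rectangle; both factors are nonzero as [phi] is injective. *)
have : (phi w.1.2 - phi x.1.2) * (phi x.1.1 - phi y.1.1) = 0.
  rewrite (_ : _ * _ = (w.2 - phi w.1.2 * phi y.1.1 - (x.2 - phi x.1.2 * phi y.1.1))
     - (w.2 - phi w.1.2 * phi x.1.1 - (x.2 - phi x.1.2 * phi x.1.1))); last by ring.
  by rewrite k1 k2 !subrr.
move/eqP; rewrite mulf_eq0 !subr_eq0 => /orP[] /eqP E.
  by apply: nh; exact: phi_inj E.
by apply: ng; exact: phi_inj E.
Qed.

Lemma card_twisted_product : #|twisted_product| = (#|G| * #|H| * p)%N.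
Proof. by rewrite /= !card_prod card_Fp. Qed.

Lemma valency_twisted x : valency twisted_adj x =
  (valency (@adj G) x.1.1 + valency (@adj H) x.1.2)%N.
Proof.
rewrite (valency_union b_g a_g).
by rewrite (valency_bij _ unassoc_bij) (valency_bij _ twist_bij) !valency_copies.
Qed.

Lemma triangles_twisted : triangles twisted_adj =
  (triangles (@adj G) * (#|H| * p) + triangles (@adj H) * (#|G| * p))%N.
Proof.
rewrite (triangles_union a_h b_g a_g b_h).
rewrite (triangles_bij _ unassoc_bij) (triangles_bij _ twist_bij) !triangles_copies.
by rewrite !card_prod card_Fp.
Qed.

Lemma squares_twisted : squares twisted_adj =
  (squares (@adj G) * (#|H| * p) + squares (@adj H) * (#|G| * p))%N.
Proof.
rewrite (squares_union a_h b_g a_g b_h aabb abab).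
rewrite (squares_bij _ unassoc_bij) (squares_bij _ twist_bij) !squares_copies.
by rewrite !card_prod card_Fp.
Qed.
End TwistedProduct.

Lemma natr_bin2 (R : pzSemiRingType) (a : nat) : 2 * 'C(a, 2)%:R = (a * (a - 1))%:R :> R.
Proof. by rewrite -natrM -mul_bin_diag bin1 subn1. Qed.

(** * Realizing points by graphs *)

Section DensitySet.
Variable R : realType.
Implicit Types (p q : R^o * R^o) (G : simple_graph).

Definition densities (T : finType) (e : rel T) : R^o * R^o :=
  ((triangles e)%:R / (6 * #|T|%:R), (squares e)%:R / (8 * #|T|%:R)).

Lemma cycle_densitiesE G :
  (cycle_density R 3 G, cycle_density R 4 G) = densities (@adj G).
Proof.
rewrite /densities /cycle_density -cycle_count3 -cycle_count4 !natrM.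
by congr pair; rewrite invfM mulrA mulfK.
Qed.

Lemma density_set_densities r (T : finType) (e : rel T) : symmetric e -> irreflexive e ->
  (0 < #|T|)%N -> (forall x, valency e x = r) -> density_set R r (densities e).
Proof.
move=> e_sym e_irr T0 e_reg; exists (SimpleGraph e_sym e_irr); split=> //.
by rewrite cycle_densitiesE.
Qed.

(** The complete graph on [a.+1] vertices, where every nonbacktracking walk with distinct ends
    closes up. *)
Lemma density_set_complete a : density_set R a
  ((a * (a - 1))%:R / 6, (a * (a - 1) * (a - 2))%:R / 8).
Proof.
pose e : rel 'I_a.+1 := fun x y => x != y.
have e_sym : symmetric e by move=> x y; rewrite /e eq_sym.
have e_irr : irreflexive e by move=> x; rewrite /e eqxx.
have e_reg x : valency e x = a.
  rewrite -[RHS]/(a.+1.-1) -[in RHS](card_ord a.+1) -(cardC1 x); apply: eq_card => y.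
  by rewrite !inE eq_sym.
have tri : triangles e = (a.+1 * (a * (a - 1)))%N.
  by rewrite (triangles_eq e_sym e_irr e_reg) ?card_ord // => x y z _ _;
    rewrite /e eq_sym.
have sq := squares_triangles_eq e_sym e_irr e_reg.
rewrite tri card_ord in sq.
have {}sq : squares e = (a.+1 * (a * (a - 1) * (a - 2)))%N.
  have {sq} := sq (fun x y z w _ _ _ _ _ wx => wx).
  move: (squares e) => n {e e_sym e_irr e_reg tri}.
  (* For [a] at most 1 the subtractions are truncated and both sides vanish. *)
  case: a => [|[|a]]; rewrite ?muln0 ?mul0n ?addn0 //.
  by rewrite (_ : a.+2 - 1 = a.+1)%N 1?(_ : a.+2 - 2 = a)%N; [nia | lia..].
have := density_set_densities e_sym e_irr _ e_reg; rewrite /densities tri sq card_ord.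
rewrite !natrM => /(_ isT); have a0 : a.+1%:R != 0 :> R by rewrite pnatr_eq0.
set u := a.+1%:R in a0 *; set v := a%:R; set v1 := (a - 1)%:R; set v2 := (a - 2)%:R.
by congr (density_set _ _ (_, _)); field.
Qed.

Lemma density_set_bipartite r : (0 < r)%N -> density_set R r (hull_point R r 0).
Proof.
move=> r0; pose e : rel (bool * 'I_r) := fun x y => x.1 != y.1.
have e_sym : symmetric e by move=> x y; rewrite /e eq_sym.
have e_irr : irreflexive e by move=> x; rewrite /e eqxx.
have e_reg x : valency e x = r.
  rewrite valencyE sum_prod big_bool /= /e /=.
  by case: x => [[] i]; rewrite /= ?sum_nat_const ?card_ord ?muln1 ?muln0 ?addn0.
have e_trans3 x y z w : e x y -> e y z -> e z w -> e w x.
  by rewrite /e; case: x.1; case: y.1; case: z.1; case: w.1.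
have tri : triangles e = 0%N.
  rewrite /triangles big1 // => x _; rewrite big1 // => y _; rewrite big1 // => z _.
  by rewrite /e; case: x.1; case: y.1; case: z.1.
have := squares_triangles_eq e_sym e_irr e_reg; rewrite tri addn0 => sq.
have {}sq := sq (fun x y z w xy yz zw _ _ _ => e_trans3 x y z w xy yz zw).
have := density_set_densities e_sym e_irr _ e_reg; rewrite /densities tri sq.
rewrite card_prod card_bool card_ord /hull_point /= muln_gt0 r0 => /(_ isT).
have r_neq0 : r%:R != 0 :> R by rewrite pnatr_eq0 -lt0n.
by congr (density_set _ _ (_, _)); rewrite ?mul0r // !natrM; field.
Qed.

(** In the twisted product every vertex lies in one copy of [G] and one copy of [H], and all
    triangles and squares lie in such copies. *)
Lemma density_set_add r s p q :
  density_set R r p -> density_set R s q -> density_set R (r + s) (p + q).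
Proof.
move=> [G [G0 Gr ->]] [H [H0 Hs ->]]; rewrite !cycle_densitiesE.
have [n ltn n_prime] := prime_above (#|G| + #|H|).
have ltG : (#|G| < n)%N by lia.
have ltH : (#|H| < n)%N by lia.
have n0 : (0 < n)%N by exact: prime_gt0.
have := @density_set_densities (r + s) _ (@twisted_adj G H n) (@twisted_sym G H n)
  (@twisted_irr G H n) _ _.
rewrite /densities triangles_twisted // squares_twisted //.
rewrite (card_twisted_product G H n_prime) !muln_gt0 G0 H0 n0 => /(_ isT) h.
have {h} := h (fun x => etrans (valency_twisted x) (congr2 addn (Gr _) (Hs _))).
have G_neq0 : #|G|%:R != 0 :> R by rewrite pnatr_eq0 -lt0n.
have H_neq0 : #|H|%:R != 0 :> R by rewrite pnatr_eq0 -lt0n.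
have n_neq0 : n%:R != 0 :> R by rewrite pnatr_eq0 -lt0n.
rewrite !natrD !natrM.
congr (density_set _ _ _); apply: injective_projections => /=; field;
  by rewrite G_neq0 H_neq0 n_neq0.
Qed.

Lemma density_set_hull_point r l : (0 < r)%N -> (l <= r)%N ->
  density_set R r (hull_point R r l).
Proof.
move=> r0; case: l => [|l lr]; first by move=> _; exact: density_set_bipartite.
(* The product of the complete graphs of degrees [a] in [s]; the empty product is a single
   vertex. *)
have main (s : seq nat) : density_set R (sumn s)
    (3^-1 * (\sum_(a <- s) 'C(a, 2))%:R, 4^-1 * (\sum_(a <- s) a * 'C(a - 1, 2))%:R).
  elim: s => [|a s IHs].
    have := density_set_complete 0; rewrite !big_nil !mul0n.
    by congr (density_set _ _ (_, _)); rewrite ?mulr0 ?mul0r.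
  have := density_set_add (density_set_complete a) IHs; rewrite !big_cons.
  congr (density_set _ _ _); apply: injective_projections => /=.
    by rewrite natrD -natr_bin2; lra.
  have a2 : 2 * 'C(a - 1, 2)%:R = (a - 1)%:R * (a - 2)%:R :> R.
    by rewrite natr_bin2 natrM -subnDA.
  by rewrite -mulnA natrD !natrM -a2; field.
have := main [seq part r l.+1 i | i <- index_iota 1 l.+2].
by rewrite sumnE !big_map sum_part.
Qed.

Lemma density_set_segment r p q (t : R) : density_set R r p -> density_set R r q ->
  rational t -> 0 <= t <= 1 -> density_set R r ((1 - t) *: p + t *: q).
Proof.
move=> [G [G0 Gr ->]] [H [H0 Hr ->]] [c _ <-] /andP[c0 c1]; rewrite !cycle_densitiesE.
rewrite ler0q -numq_ge0 in c0.
pose num := `|numq c|%N; pose den := `|denq c|%N.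
have cE : ratr c = num%:R / den%:R :> R.
  by rewrite /ratr -{1}(gez0_abs c0) -{1}(gez0_abs (denq_ge0 c)).
have den0 : (0 < den)%N by rewrite absz_gt0 denq_neq0.
have le_nd : (num <= den)%N.
  by move: c1; rewrite cE ler_pdivrMr ?ltr0n // mul1r ler_nat.
(* Numbers of copies of [G] and [H]. The factors [#|H|] and [#|G|] compensate for the different
   orders, so that the vertices are shared in the ratio [1 - t] to [t]. *)
pose a := ((den - num) * #|H|)%N; pose b := (num * #|G|)%N.
pose e := sum_rel (copies (K := 'I_a) (@adj G)) (copies (K := 'I_b) (@adj H)).
have e_sym : symmetric e.
  by move=> [x|x] [y|y] //=; rewrite /copies adj_sym eq_sym.
have e_irr : irreflexive e by move=> [x|x] /=; rewrite /copies adj_irr.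
have e_reg x : valency e x = r.
  by rewrite valency_sum; case: x => x; rewrite valency_copies; [exact: Gr | exact: Hr].
have cardE : #|{: G * 'I_a + H * 'I_b}| = (den * (#|G| * #|H|))%N.
  by rewrite card_sum !card_prod !card_ord /a /b; nia.
have := density_set_densities e_sym e_irr _ e_reg.
rewrite /densities cardE !muln_gt0 den0 G0 H0 => /(_ isT).
rewrite triangles_sum squares_sum !triangles_copies !squares_copies !card_ord.
have G_neq0 : #|G|%:R != 0 :> R by rewrite pnatr_eq0 -lt0n.
have H_neq0 : #|H|%:R != 0 :> R by rewrite pnatr_eq0 -lt0n.
have d_neq0 : den%:R != 0 :> R by rewrite pnatr_eq0 -lt0n.
rewrite cE /a /b !natrD !natrM natrB //.
congr (density_set _ _ _); apply: injective_projections; rewrite /= /GRing.scale /=;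
  field;
  by rewrite G_neq0 H_neq0 d_neq0.
Qed.

End DensitySet.

(** * The polygon *)

Section LowerHull.
Variables (R : realFieldType) (I : finType) (X Y : I -> R) (x y : R).
Hypothesis above : forall lambda, exists i, Y i - lambda * X i <= y - lambda * x.

(** Take the chord that is lowest over [x], and through its point there the line of least slope to a
    point on the right. No point lies below this line, and [above] for its slope bounds the height
    of the chord by [y]. *)
Lemma lower_segment i0 j0 : X i0 <= x -> x < X j0 -> exists i j,
  X i <= x < X j /\ Y i + (x - X i) / (X j - X i) * (Y j - Y i) <= y.
Proof.
move=> i0x xj0.
pose P (ij : I * I) := X ij.1 <= x < X ij.2.
pose val (ij : I * I) := Y ij.1 + (x - X ij.1) / (X ij.2 - X ij.1) * (Y ij.2 - Y ij.1).
have P0 : P (i0, j0) by rewrite /P i0x xj0.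
have [[i j] /= ijP min_v] := arg_minP val P0.
exists i, j; split=> //; rewrite -[X in X <= _]/(val (i, j)).
pose slope m := (Y m - val (i, j)) / (X m - x).
have [j1 xj1 min_s] := @arg_minP _ _ _ j0 (fun j => x < X j) slope xj0.
have [m le_m] := above (slope j1).
suff : val (i, j) - slope j1 * x <= Y m - slope j1 * X m by lra.
(* On the right the least slope decides. On the left, the chord from [m] to [j1] is not lower over
   [x] than the chosen one. *)
have [mx|xm] := lerP (X m) x; last first.
  have := min_s m xm; rewrite {2}/slope ler_pdivlMr ?subr_gt0 //; lra.
have := min_v (m, j1) (_ : P _); rewrite /P /= mx xj1 => /(_ isT).
have Bgt0 : 0 < X j1 - x by rewrite subr_gt0.
have Yj1 : Y j1 = val (i, j) + slope j1 * (X j1 - x).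
  by rewrite /slope divfK ?gt_eqF // addrC subrK.
move: (val (i, j)) (slope j1) Yj1 => v s Yj1.
rewrite /val /= Yj1.
set A := x - X m; set B := X j1 - x.
have -> : X j1 - X m = A + B by rewrite /A /B; ring.
have A0 : 0 <= A by rewrite subr_ge0.
have AB : 0 < A + B by rewrite ltr_wpDl.
rewrite -(ler_pM2r AB) mulrDl mulrAC divfK ?gt_eqF // => h.
have {}h : 0 <= B * (Y m - v + s * A) by move: h; rewrite -/B; nra.
by move: h; rewrite pmulr_rge0 // /A; lra.
Qed.

Lemma lower_end : (forall i, X i <= x) -> exists i, X i = x /\ Y i <= y.
Proof.
move=> le_x.
(* A slope so steep that the minimum it yields can only be attained over [x]. *)
pose s := 1 + \sum_i `|(y - Y i) / (x - X i)|.
have [i] := above s.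
have [xi le_i|xi] := eqVneq (X i) x; first by exists i; rewrite -xi in le_i *; split;
  [|lra].
have xi0 : 0 < x - X i by rewrite subr_gt0 lt_neqAle xi le_x.
have : (y - Y i) / (x - X i) < s.
  rewrite /s (bigD1 i) //=; apply: (le_lt_trans (ler_norm _)).
  rewrite addrCA ltrDl ltr_pwDl // sumr_ge0 //.
by rewrite ltr_pdivrMr //; lra.
Qed.
End LowerHull.

(** * Inequalities satisfied by the densities *)

Section Feasible.
Variables (R : realType) (r : nat).
Hypothesis r_gt1 : (1 < r)%N.
Implicit Types p q : R^o * R^o.
Let P := hull_point R r.

(* The inequalities defining the polygon: the line through [P 0] and [P 1]
   bounds it from above, and each direction of negative second coordinate is
   minimized at some [P l]. *)
Definition feasible p : Prop :=
  [/\ 0 <= p.1 <= (P 1).1, p.2 + 3 / 4 * p.1 <= (P 0).2 &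
    forall lambda : R, exists l, (1 <= l <= r)%N /\
      (P l).2 - lambda * (P l).1 <= p.2 - lambda * p.1].

Lemma hull_point0 : P 0 = (0, (r * (r - 1) ^ 2)%:R / 8).
Proof. by []. Qed.

Lemma hull_point1 : P 1 = ((r * (r - 1))%:R / 6, (r * (r - 1) * (r - 2))%:R / 8).
Proof.
rewrite /P /hull_point /= !big_nat1 /part addnK divn1.
congr pair; first by rewrite -natr_bin2; field.
have := natr_bin2 R (r - 1)%N; rewrite -subnDA natrM -mulnA !natrM => <-; by field.
Qed.

(** Identifies minimizing [d_4 - lambda d_3] over the [P l] with minimizing the sum of cubics for
    [k = 3 + 4 / 3 * lambda]. *)
Lemma hull_point_cubic l lambda : (0 < l)%N ->
  8 * ((P l).2 - lambda * (P l).1) =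
  \sum_(1 <= i < l.+1) cubic (3 + 4 / 3 * lambda) (part r l i)
    + (2 + 4 / 3 * lambda) * r%:R.
Proof.
move=> l0; rewrite -[in r%:R](sum_part r l0) natr_sum mulr_sumr -big_split /=.
rewrite /P /hull_point gtn_eqF //= !natr_sum !mulr_sumr -sumrB mulr_sumr.
apply: eq_bigr => i _; rewrite natrM /cubic.
case: (part r l i) => [|[|a]].
- by rewrite !bin_small //=; ring.
- by rewrite !bin_small //=; ring.
have := natr_bin2 R a.+2; have := natr_bin2 R a.+1.
rewrite !subSS !subn0 !natrM -!natr1 => h1 h2.
have -> : 'C(a.+1, 2)%:R = (a%:R + 1) * a%:R / 2 :> R by rewrite -h1; field.
have -> : 'C(a.+2, 2)%:R = (a%:R + 1 + 1) * (a%:R + 1) / 2 :> R by rewrite -h2; field.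
by field.
Qed.

Lemma density_set_feasible p : density_set R r p -> feasible p.
Proof.
move=> [G [G0 Gr ->]]; rewrite cycle_densitiesE /densities.
have e_sym := @adj_sym G; have e_irr := @adj_irr G.
have n0 : 0 < #|G|%:R :> R by rewrite ltr0n.
have n_neq0 : #|G|%:R != 0 :> R by rewrite gt_eqF.
split=> [||lambda].
- rewrite hull_point1 /= divr_ge0 ?mulr_ge0 //= ler_pdivrMr ?mulr_gt0 //.
  rewrite mulrA divfK // -natrM ler_nat mulnC.
  exact: triangles_le e_sym e_irr Gr.
- have := squares_triangles_le e_sym e_irr Gr.
  rewrite hull_point0 /= -(ler_nat R) natrD natrM => h.
  rewrite -(ler_pM2r n0) -subr_ge0 -(pmulr_rge0 _ (_ : 0 < 8 :> R)) //.
  move: h; rewrite -subr_ge0; congr (0 <= _); field.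
  by rewrite n_neq0.
(* For this [k], [k - 3] is [8 / 6 * lambda], which accounts for the multiplicities 8 and 6 of
   squares and triangles. *)
have [|l [/andP[l1 lr] le_l]] :=
  squares_triangles_ge (3 + 4 / 3 * lambda) e_sym e_irr Gr; first by lia.
exists l; rewrite l1 lr; split=> //.
rewrite -(ler_pM2l (_ : 0 < 8 :> R)) // hull_point_cubic //.
rewrite -(ler_pM2l n0) -subr_ge0; move: le_l; rewrite -subr_ge0 /=.
set S := \sum_(_ <= _ < _) _; congr (0 <= _).
by field; rewrite n_neq0.
Qed.

End Feasible.

Local Open Scope classical_set_scope.
Local Open Scope ring_scope.

(** * The inequalities describe the hull *)

Section Polygon.
Variables (R : realType) (r : nat).
Hypothesis r_gt1 : (1 < r)%N.
Implicit Types p q : R^o * R^o.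
Let P := hull_point R r.
Let r_gt0 : (0 < r)%N := ltnW r_gt1.

Section WeightedHull.
Variables (K : set R) (S : set (R^o * R^o)).
Hypotheses (K_sub : forall a b, K a -> K b -> K (a - b))
           (K_mul : forall a b, K a -> K b -> K (a * b))
           (K_div : forall a b, K a -> K b -> K (a / b)).
Hypotheses (K_P1 : forall l, (l <= r)%N -> K (P l).1)
           (K_P2 : forall l, (l <= r)%N -> K (P l).2)
           (S_P : forall l, (l <= r)%N -> S (P l)).
Hypothesis S_segment : forall p q t, S p -> S q -> K t -> 0 <= t <= 1 ->
  S ((1 - t) *: p + t *: q).

Let S_segmentE p q t : S p -> S q -> K t -> 0 <= t <= 1 ->
  S (p.1 + t * (q.1 - p.1), p.2 + t * (q.2 - p.2)).
Proof.
move=> Sp Sq Kt t01; have := S_segment Sp Sq Kt t01.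
by congr S; apply: injective_projections => /=; rewrite /GRing.scale /=; ring.
Qed.

Let K_segmentE a b t : K a -> K b -> K t -> K (a + t * (b - a)).
Proof.
move=> Ka Kb Kt; rewrite -[b - a]opprB mulrN.
by apply: K_sub => //; apply: K_mul => //; exact: K_sub.
Qed.

(** Serves twice: with [K] the rationals and [S] the density set, and with [K] all reals and [S] any
    convex set containing the [P l]. The point lies on a vertical segment from a lower point [v] to
    a point [u] of the edge from [P 0] to [P 1]; all weights are quotients of differences in [K]. *)
Lemma feasible_hull p : feasible r p -> K p.1 -> K p.2 -> S p.
Proof.
case: p => x y [/= /andP[x0 x1] le_y above] Kx Ky.
have X1_gt0 : 0 < (hull_point R r 1).1.
  by rewrite hull_point1 /= divr_gt0 // ltr0n; lia.
have [v [Sv Kv le_v]] : exists v, [/\ S (x, v), K v & v <= y].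
  have above' lambda : exists i : 'I_r.+1, (P i).2 - lambda * (P i).1 <= y - lambda * x.
    have [l [/andP[l1 lr] le_l]] := above lambda.
    by have lr' : (l < r.+1)%N by []; exists (Ordinal lr').
  have ltr (i : 'I_r.+1) : (i <= r)%N by rewrite -ltnS.
  have r1 : (1 < r.+1)%N by lia.
  (* [P 1] is rightmost, as every [P i] is realized by a graph; over its abscissa no chord extends
     to the right. *)
  have [x1'|x_lt] := lerP (P 1).1 x.
    have [i|i [Xi le_i]] := lower_end above'.
      have /density_set_feasible[] := density_set_hull_point R r_gt0 (ltr i) =>
        // /andP[_ le_i] _ _.
      exact: le_trans le_i x1'.
    exists (P i).2; split=> //; last exact: K_P2.
    by have := S_P (ltr i); rewrite [P i]surjective_pairing Xi.
  have [|i [j [/andP[ix xj] le_i]]] :=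
    lower_segment above' (i0 := ord0) (j0 := Ordinal r1) _ x_lt.
    exact: x0.
  have d0 : 0 < (P j).1 - (P i).1 by rewrite subr_gt0 (le_lt_trans ix).
  pose t := (x - (P i).1) / ((P j).1 - (P i).1).
  have Kt : K t by apply: K_div; apply: K_sub => //; exact: K_P1.
  exists ((P i).2 + t * ((P j).2 - (P i).2)); split=> //.
    have := S_segmentE (S_P (ltr i)) (S_P (ltr j)) Kt.
    rewrite /t divfK ?gt_eqF // subrKC; apply.
    by rewrite divr_ge0 ?(ltW d0) ?subr_ge0 //= ler_pdivrMr // mul1r lerD2r ltW.
  by apply: K_segmentE => //; exact: K_P2.
pose t := x / (P 1).1.
pose u := (P 0).2 + t * ((P 1).2 - (P 0).2).
have Kt : K t by apply: K_div => //; exact: K_P1.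
have Su : S (x, u).
  have := S_segmentE (S_P (leq0n r)) (S_P r_gt0) Kt.
  rewrite /= subr0 add0r /t divfK ?gt_eqF //; apply.
  by rewrite divr_ge0 ?(ltW X1_gt0) //= ler_pdivrMr // mul1r.
have le_u : y <= u.
  apply: le_trans (_ : y <= (P 0).2 - 3 / 4 * x) _; first by rewrite lerBrDr.
  rewrite /u /t le_eqVlt; apply/orP; left; apply/eqP.
  have -> : (P 1).2 = (P 0).2 - 3 / 4 * (P 1).1.
    by rewrite /P hull_point0 hull_point1 /= !natrM !natrB //; field.
  by field; rewrite gt_eqF.
have Ku : K u by apply: K_segmentE => //; exact: K_P2.
have Kc : K ((y - v) / (u - v)) by apply: K_div; exact: K_sub.
have := S_segmentE Sv Su Kc; rewrite /= subrr mulr0 addr0.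
(* If the segment is a point, division by zero makes the weight 0. *)
have [uv|uv] := eqVneq u v.
  have yv : y = v by apply/le_anti; rewrite le_v -uv le_u.
  by rewrite uv subrr invr0 mulr0 mul0r addr0 yv; apply; rewrite lexx ler01.
rewrite divfK ?subr_eq0 // subrKC; apply.
have d0 : 0 < u - v by rewrite subr_gt0 lt_neqAle eq_sym uv (le_trans le_v).
by rewrite divr_ge0 ?(ltW d0) ?subr_ge0 //= ler_pdivrMr // mul1r lerD2r.
Qed.
End WeightedHull.

(** For each [lambda], the index with the smaller value serves both points. *)
Lemma feasible_convex p q (t : R) : feasible r p -> feasible r q -> 0 <= t <= 1 ->
  feasible r (t *: p + (1 - t) *: q).
Proof.
case: p q => [x y] [x' y'] [/= /andP[x0 x1] le_y above] [/= /andP[x0' x1'] le_y' above'].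
move=> /andP[t0 t1].
have s0 : 0 <= 1 - t by rewrite subr_ge0.
split; rewrite /= /GRing.scale /=.
- apply/andP; split; first by rewrite addr_ge0 ?mulr_ge0.
  by have := lerD (ler_wpM2l t0 x1) (ler_wpM2l s0 x1'); lra.
- by have := lerD (ler_wpM2l t0 le_y) (ler_wpM2l s0 le_y'); lra.
move=> lambda; have [l [lr le_l]] := above lambda; have [l' [lr' le_l']] := above' lambda.
rewrite -/P in le_l le_l' *.
have [ll'|ll'] := lerP ((P l).2 - lambda * (P l).1) ((P l').2 - lambda * (P l').1).
  exists l; split=> //.
  by have := lerD (ler_wpM2l t0 le_l) (ler_wpM2l s0 (le_trans ll' le_l')); lra.
exists l'; split=> //.
by have := lerD (ler_wpM2l t0 (le_trans (ltW ll') le_l)) (ler_wpM2l s0 le_l'); lra.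
Qed.

Lemma density_polygonE : density_polygon R r = [set p | feasible r p].
Proof.
apply/seteqP; split=> p.
  apply: (@smallest_sub _ _ _ [set p | feasible r p]).
    move=> a b t; rewrite !inE => fa fb.
    have := feasible_convex fa fb (t := t%:num); apply.
    by rewrite ge0 le1.
  move=> _ [l lr <-]; apply: density_set_feasible => //.
  exact: density_set_hull_point.
move=> fp A [A_convex PA].
apply: (@feasible_hull setT A) => //.
  by move=> l lr; apply: PA; exists l.
move=> a b t Aa Ab _ /andP[t0 t1].
pose t' := Itv01 t0 t1.
have := @A_convex b a t'; rewrite !inE => /(_ Ab Aa).
by rewrite addrC.
Qed.
End Polygon.

(** * Rational weights and closures *)

Section Rational.
Variable R : realType.
Implicit Types a b t : R.

Lemma rational_sub a b : rational a -> rational b -> rational (a - b).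
Proof. by move=> [u _ <-] [v _ <-]; exists (u - v); rewrite // rmorphB. Qed.

Lemma rational_mul a b : rational a -> rational b -> rational (a * b).
Proof. by move=> [u _ <-] [v _ <-]; exists (u * v); rewrite // rmorphM. Qed.

Lemma rational_div a b : rational a -> rational b -> rational (a / b).
Proof. by move=> [u _ <-] [v _ <-]; exists (u / v); rewrite // fmorph_div. Qed.

Lemma rational_nat n : rational (n%:R : R).
Proof. by exists n%:R; rewrite // ratr_nat. Qed.

Lemma rational01_near t e : 0 <= t <= 1 -> 0 < e ->
  exists s, [/\ rational s, 0 <= s <= 1 & `|t - s| < e].
Proof.
move=> /andP[t0 t1] e0; have [->|t_neq1] := eqVneq t 1.
  by exists 1; rewrite subrr normr0 ler01 lexx e0; split=> //; exists 1; rewrite ?rmorph1.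
have lt_t : t < Num.min 1 (t + e) by rewrite lt_min lt_neqAle t_neq1 t1 ltrDl.
have [c] := rat_in_itvoo lt_t; rewrite in_itv /= lt_min => /and3P[tc c1 ce].
exists (ratr c); split; first by exists c.
  by rewrite (ltW c1) (le_trans t0) // ltW.
by rewrite distrC gtr0_norm ?subr_gt0 // ltrBlDl.
Qed.
End Rational.

Section Closure.
Variable R : realType.
Implicit Types (S : set (R^o * R^o)) (p q : R^o * R^o).

Lemma closure_half_plane S (a b c : R) :
  (forall q, S q -> c <= a * q.1 + b * q.2) ->
  forall p, closure S p -> c <= a * p.1 + b * p.2.
Proof.
move=> S_ge p Sp.
pose f (q : R^o * R^o) : R^o := a * q.1 + b * q.2.
have f_cts : continuous f.
  move=> q; apply: cvgD.
    by apply: cvgMr; exact: cvg_fst.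
  by apply: cvgMr; exact: cvg_snd.
have f_closed : closed (f @^-1` [set x | c <= x]).
  by apply: closed_comp => [x _|]; [exact: f_cts | exact: closed_ge].
suff : (f @^-1` [set x | c <= x]) p by [].
rewrite ((closure_id (f @^-1` [set x | c <= x])).1 f_closed).
by apply: closure_subset Sp => q; exact: S_ge.
Qed.

(** The combination is jointly continuous in the weight and the endpoints, so all three are
    approximated at once, the weight by a rational in the unit interval. *)
Lemma closure_segment S p q (t : R) :
  (forall u v s, S u -> S v -> rational s -> 0 <= s <= 1 -> S ((1 - s) *: u + s *: v)) ->
  closure S p -> closure S q -> 0 <= t <= 1 -> closure S ((1 - t) *: p + t *: q).
Proof.
move=> S_seg Sp Sq t01.
pose f (z : R^o * ((R^o * R^o) * (R^o * R^o))) : R^o * R^o :=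
  (1 - z.1) *: z.2.1 + z.1 *: z.2.2.
have f_cts : continuous f.
  move=> z; apply: cvgD; apply: cvgZ.
  - by apply: cvgB; [exact: cvg_cst | exact: cvg_fst].
  - by apply: (cvg_comp _ _ cvg_snd); exact: cvg_fst.
  - exact: cvg_fst.
  - by apply: (cvg_comp _ _ cvg_snd); exact: cvg_snd.
move=> B /(f_cts (t, (p, q))) [[U V] /= [Ut [[V1 V2] /= [V1p V2q] V12]] UV].
have [u [Su V1u]] := Sp _ V1p; have [v [Sv V2v]] := Sq _ V2q.
have [e /= e0 eU] := Ut.
have [s [s_rat s01 ts]] := rational01_near t01 e0.
exists (f (s, (u, v))); split; first exact: S_seg.
by apply: UV; split => /=; [exact: eU | exact: V12].
Qed.
End Closure.

Theorem theorem2p2 (R : realType) (r : nat) (r_ge3 : (3 <= r)%N) :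
  density_set R r =
    [set p | density_polygon R r p /\ rational p.1 /\ rational p.2] /\
  closure (density_set R r) = density_polygon R r.
Proof.
have r_gt1 : (1 < r)%N by exact: ltnW.
have r_gt0 : (0 < r)%N by exact: ltnW.
have dens_rat p : density_set R r p -> rational p.1 /\ rational p.2.
  move=> [G [_ _ ->]]; rewrite cycle_densitiesE /= -!natrM.
  by split; apply: rational_div; exact: rational_nat.
have dens_P l : (l <= r)%N -> density_set R r (hull_point R r l).
  exact: density_set_hull_point.
split; apply/seteqP; split=> p.
- move=> dp; split; last exact: dens_rat.
  by rewrite density_polygonE //; exact: density_set_feasible.
- rewrite density_polygonE // => -[fp [p1 p2]].
  apply: (feasible_hull r_gt1 (K := rational)) fp p1 p2 => //.
  + exact: rational_sub.
  + exact: rational_mul.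
  + exact: rational_div.
  + by move=> l /dens_P/dens_rat[].
  + by move=> l /dens_P/dens_rat[].
  + by move=> u v t; exact: density_set_segment.
- move=> cp; rewrite density_polygonE //.
  (* Linear inequalities valid at all feasible points hold on the density set and pass to its
     closure. *)
  have ge a b c : (forall q, feasible r q -> c <= a * q.1 + b * q.2) ->
      c <= a * p.1 + b * p.2.
    by move=> h; apply: closure_half_plane cp => q /(density_set_feasible r_gt1);
      exact: h.
  split.
  + apply/andP; split.
      have := ge 1 0 0; rewrite mul1r mul0r addr0; apply=> q [/andP[q0 _] _ _].
      by rewrite mul1r mul0r addr0.
    have := ge (-1) 0 (- (hull_point R r 1).1); rewrite mulN1r mul0r addr0 lerN2;
      apply=> q [/andP[_ q1] _ _].
    by rewrite mulN1r mul0r addr0 lerN2.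
  + have := ge (- (3 / 4)) (-1) (- (hull_point R r 0).2) => h.
    suff : - (hull_point R r 0).2 <= - (3 / 4) * p.1 + -1 * p.2 by lra.
    by apply: h => q [_ q2 _]; lra.
  move=> lambda.
  (* For fixed [lambda] the third condition is a single closed half-plane, bounded by the minimum of
     [val] over [1 <= l <= r]; indices in ['I_r] are shifted by one. *)
  pose val l := (hull_point R r l).2 - lambda * (hull_point R r l).1.
  have [i _ min_i] :=
    @arg_minP _ _ _ (Ordinal r_gt0) xpredT (fun i : 'I_r => val i.+1) isT.
  exists i.+1; rewrite ltn_ord; split=> //; rewrite -/(val _).
  rewrite addrC -mulNr -[p.2]mul1r; apply: ge =>
    q [_ _ /(_ lambda)[l [/andP[l1 lr] le_l]]].
  rewrite mul1r mulNr addrC; apply: le_trans le_l.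
  have lr' : (l.-1 < r)%N by rewrite prednK.
  by have := min_i (Ordinal lr') isT; rewrite /= prednK.
(* Conversely, the closure is convex and contains the generating points. *)
apply: smallest_sub p => [a b t|_ [l lr <-]]; last first.
  by apply: subset_closure; exact: dens_P.
rewrite !inE => ca cb; rewrite /conv /= addrC.
have := closure_segment (t := t%:num) _ cb ca; apply; last by rewrite ge0 le1.
by move=> u v s; exact: density_set_segment.
Qed.
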